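(* It is provable in $\mathbf{ZF}$ that there exists a countable metrizable space $(Z,\tau)$ such that the space $(Z,\tau^{\star})$, where $\tau^{\star}$ is the compact complement topology of $(Z,\tau)$, is not first countable.
   Context: All work is in $\mathbf{ZF}$ (no axiom of choice). For a Hausdorff space $(Z,\tau)$ with $Z$ infinite, the compact complement topology of $(Z,\tau)$ is $\tau^{\star}=\{\emptyset\}\cup\{Z\setminus M : M \text{ is compact in } (Z,\tau)\}$, which is a topology on $Z$. Compact means that every open cover has a finite subcover. *)

(* Defs.v *)
(* ZF as a first-order theory: formulas, a deduction calculus, the axioms, and
   the topological notions written as formulas in the language of set theory.
   Stdlib only. *)
From Stdlib Require Import List Arith.
Import ListNotations.

(** * First-order logic with equality over one binary relation symbol *)

(* De Bruijn indices; the language has no function symbols, so the only terms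
   are variables. *)
Inductive form : Type :=
| Mem (x y : nat)
| Eql (x y : nat)
| Bot
| Imp (p q : form)
| All (p : form).

Definition Neg p := Imp p Bot.
Definition And p q := Neg (Imp p (Neg q)).
Definition Or p q := Imp (Neg p) q.
Definition Iff p q := And (Imp p q) (Imp q p).
Definition Ex p := Neg (All (Neg p)).

Definition up (r : nat -> nat) (i : nat) : nat :=
  match i with 0 => 0 | S k => S (r k) end.

Fixpoint ren (r : nat -> nat) (p : form) : form :=
  match p with
  | Mem x y => Mem (r x) (r y)
  | Eql x y => Eql (r x) (r y)
  | Bot => Bot
  | Imp p q => Imp (ren r p) (ren r q)
  | All p => All (ren (up r) p)
  end.

Definition shift : form -> form := ren S.

(* [inst x p] is the body [p] of a quantifier with its bound variable
   replaced by the variable [x]. *)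
Definition inst (x : nat) : form -> form :=
  ren (fun i => match i with 0 => x | S k => k end).

(* All free variables of [p] are below [n]. *)
Fixpoint bounded (n : nat) (p : form) : Prop :=
  match p with
  | Mem x y | Eql x y => x < n /\ y < n
  | Bot => True
  | Imp p q => bounded n p /\ bounded n q
  | All p => bounded (S n) p
  end.

Reserved Notation "G ⊢ p" (at level 70).

(* Classical natural deduction. *)
Inductive deriv : list form -> form -> Prop :=
| D_hyp G p : In p G -> G ⊢ p
| D_impI G p q : (p :: G) ⊢ q -> G ⊢ Imp p q
| D_impE G p q : G ⊢ Imp p q -> G ⊢ p -> G ⊢ q
| D_raa G p : (Neg p :: G) ⊢ Bot -> G ⊢ p
| D_allI G p : map shift G ⊢ p -> G ⊢ All p
| D_allE G p x : G ⊢ All p -> G ⊢ inst x p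
| D_eqI G x : G ⊢ Eql x x
| D_eqE G p x y : G ⊢ Eql x y -> G ⊢ inst x p -> G ⊢ inst y p
where "G ⊢ p" := (deriv G p).

(* [p] has a derivation from finitely many axioms of [T]. *)
Definition provable (T : form -> Prop) (p : form) : Prop :=
  exists G : list form, (forall q, In q G -> T q) /\ G ⊢ p.

(** * Writing formulas with named variables *)

(* A [fml] is a formula awaiting the number of quantifiers it stands under.
   Variables are de Bruijn levels: the variable bound by a quantifier standing
   under [n] others is [n], which inside a body at depth [d] has index
   [d - S n].  A quantifier can thus be given as a Rocq function of the
   variable it binds, and no predicate below needs index shifting. *)
Definition var := nat.
Definition fml := nat -> form.

Declare Scope fml_scope.
Delimit Scope fml_scope with fml.
Bind Scope fml_scope with fml.

Definition fMem (x y : var) : fml := fun d => Mem (d - S x) (d - S y).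
Definition fEql (x y : var) : fml := fun d => Eql (d - S x) (d - S y).
Definition fNeg (p : fml) : fml := fun d => Neg (p d).
Definition fAnd (p q : fml) : fml := fun d => And (p d) (q d).
Definition fOr (p q : fml) : fml := fun d => Or (p d) (q d).
Definition fImp (p q : fml) : fml := fun d => Imp (p d) (q d).
Definition fIff (p q : fml) : fml := fun d => Iff (p d) (q d).
Definition fAll (p : var -> fml) : fml := fun d => All (p d (S d)).
Definition fEx (p : var -> fml) : fml := fun d => Ex (p d (S d)).

Definition sentence (p : fml) : form := p 0.

Notation "x ∈ y" := (fMem x y) (at level 70) : fml_scope.
Notation "x ≈ y" := (fEql x y) (at level 70) : fml_scope.
Notation "¬ p" := (fNeg p) (at level 75, right associativity) : fml_scope.
Notation "p ∧ q" := (fAnd p q) (at level 80, right associativity) : fml_scope.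
Notation "p ∨ q" := (fOr p q) (at level 85, right associativity) : fml_scope.
Notation "p ⇒ q" := (fImp p q) (at level 99, q at level 200,
  right associativity) : fml_scope.
Notation "p ⇔ q" := (fIff p q) (at level 95, no associativity) : fml_scope.
Notation "∀ x .. y , p" := (fAll (fun x => .. (fAll (fun y => p%fml)) .. ))
  (at level 200, x binder, y binder, right associativity) : fml_scope.
Notation "∃ x .. y , p" := (fEx (fun x => .. (fEx (fun y => p%fml)) .. ))
  (at level 200, x binder, y binder, right associativity) : fml_scope.
Notation "∀[ x ∈ A ] p" := (fAll (fun x => fImp (fMem x A) p%fml))
  (at level 200, x name, A at level 69, p at level 200) : fml_scope.
Notation "∃[ x ∈ A ] p" := (fEx (fun x => fAnd (fMem x A) p%fml))
  (at level 200, x name, A at level 69, p at level 200) : fml_scope.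

Local Open Scope fml_scope.

(* Quantify over [n] variables, passed to the body as a list. *)
Fixpoint fAlls (n : nat) (p : list var -> fml) : fml :=
  match n with
  | 0 => p nil
  | S k => ∀ x, fAlls k (fun l => p (x :: l))
  end.

(* The formula [p] with its free variables 0, 1, 2, ... replaced by the
   members of [l]; used with [bounded (length l) p]. *)
Definition fApp (p : form) (l : list var) : fml :=
  fun d => ren (fun i => d - S (nth i l 0)) p.

(** * The axioms of ZF *)

Definition Empty (x : var) : fml := ¬ ∃ y, y ∈ x.
Definition Subset (x y : var) : fml := ∀[ z ∈ x ] z ∈ y.
(* s = x ∪ {x} *)
Definition Succ (s x : var) : fml := ∀ z, z ∈ s ⇔ (z ∈ x ∨ z ≈ x).
Definition Inductive_ (w : var) : fml :=
  (∃[ e ∈ w ] Empty e) ∧ ∀[ x ∈ w ] ∃[ s ∈ w ] Succ s x.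
(* p = {x, y} *)
Definition UPair (p x y : var) : fml := ∀ z, z ∈ p ⇔ (z ≈ x ∨ z ≈ y).
(* u = ⋃ c *)
Definition Union (u c : var) : fml := ∀ x, x ∈ u ⇔ ∃[ y ∈ c ] x ∈ y.

(* In the two schemes the free variables 1, 2, ... of [p] (resp. 2, 3, ...)
   are parameters; variable 0 (resp. variables 0 and 1) is what the scheme
   comprehends over. *)
Inductive ZF : form -> Prop :=
| ZF_ext : ZF (sentence (∀ x y, (∀ z, z ∈ x ⇔ z ∈ y) ⇒ x ≈ y))
| ZF_found : ZF (sentence
    (∀ x, (∃ y, y ∈ x) ⇒ ∃[ y ∈ x ] ¬ ∃[ z ∈ x ] z ∈ y))
| ZF_pair : ZF (sentence (∀ x y, ∃ p, UPair p x y))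
| ZF_union : ZF (sentence (∀ c, ∃ u, Union u c))
| ZF_power : ZF (sentence (∀ x, ∃ y, ∀ z, z ∈ y ⇔ Subset z x))
| ZF_inf : ZF (sentence (∃ w, Inductive_ w))
| ZF_sep n p : bounded (S n) p -> ZF (sentence (fAlls n (fun l =>
    ∀ a, ∃ b, ∀ x, x ∈ b ⇔ (x ∈ a ∧ fApp p (x :: l)))))
| ZF_repl n p : bounded (S (S n)) p -> ZF (sentence (fAlls n (fun l =>
    ∀ a,
      (∀[ x ∈ a ] ∀ y z,
         fApp p (x :: y :: l) ∧ fApp p (x :: z :: l) ⇒ y ≈ z) ⇒
      ∃ b, ∀ y, y ∈ b ⇔ ∃[ x ∈ a ] fApp p (x :: y :: l)))).

(** * Pairs, functions, natural numbers, cardinality *)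

(* p = (x, y), Kuratowski *)
Definition OPair (p x y : var) : fml :=
  ∃ u v, UPair u x x ∧ UPair v x y ∧ UPair p u v.
(* (x, y) ∈ f *)
Definition Rel (f x y : var) : fml := ∃[ p ∈ f ] OPair p x y.
(* f maps (x, y) to z *)
Definition Rel2 (f x y z : var) : fml := ∃ p, OPair p x y ∧ Rel f p z.

Definition Prod (P A B : var) : fml :=
  ∀ p, p ∈ P ⇔ ∃[ x ∈ A ] ∃[ y ∈ B ] OPair p x y.
Definition Fun (f A B : var) : fml :=
  (∀[ p ∈ f ] ∃[ x ∈ A ] ∃[ y ∈ B ] OPair p x y) ∧
  (∀[ x ∈ A ] ∃ y, Rel f x y) ∧
  (∀ x y z, Rel f x y ∧ Rel f x z ⇒ y ≈ z).
Definition Fun2 (f A B : var) : fml := ∃ P, Prod P A A ∧ Fun f P B.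
Definition Injection (f A B : var) : fml :=
  Fun f A B ∧ ∀ x y z, Rel f x z ∧ Rel f y z ⇒ x ≈ y.
Definition Bijection (f A B : var) : fml :=
  Injection f A B ∧ ∀[ y ∈ B ] ∃ x, Rel f x y.

Definition Omega (w : var) : fml :=
  Inductive_ w ∧ ∀ v, Inductive_ v ⇒ Subset w v.

Definition Countable (A : var) : fml := ∃ w f, Omega w ∧ Injection f A w.
Definition Finite (A : var) : fml :=
  ∃ w n f, Omega w ∧ n ∈ w ∧ Bijection f A n.

(** * Nonnegative real numbers *)

(* Addition and multiplication on w = ω, by their recursion equations. *)
Definition Addition (a w : var) : fml :=
  Fun2 a w w ∧
  (∀[ x ∈ w ] ∀ e, Empty e ⇒ Rel2 a x e x) ∧
  (∀ x y z s t, Rel2 a x y z ∧ Succ s y ∧ Succ t z ⇒ Rel2 a x s t).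
Definition Multiplication (m a w : var) : fml :=
  Fun2 m w w ∧
  (∀[ x ∈ w ] ∀ e, Empty e ⇒ Rel2 m x e e) ∧
  (∀ x y z s t, Rel2 m x y z ∧ Succ s y ∧ Rel2 a z x t ⇒ Rel2 m x s t).

(* F is the set of fractions i/j with i, j positive, coded as pairs (i, j). *)
Definition Fractions (F w : var) : fml :=
  ∀ p, p ∈ F ⇔
    ∃[ i ∈ w ] ∃[ j ∈ w ] (¬ Empty i ∧ ¬ Empty j ∧ OPair p i j).
(* i/j < k/l  iff  i l < k j *)
Definition FracLt (m p q : var) : fml :=
  ∃ i j k l u v, OPair p i j ∧ OPair q k l ∧
    Rel2 m i l u ∧ Rel2 m k j v ∧ u ∈ v.
Definition FracLe (m p q : var) : fml := ¬ FracLt m q p.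
(* r = i/j + k/l = (i l + k j) / (j l) *)
Definition FracAdd (a m r p q : var) : fml :=
  ∃ i j k l u v s t, OPair p i j ∧ OPair q k l ∧
    Rel2 m i l u ∧ Rel2 m k j v ∧ Rel2 a u v s ∧ Rel2 m j l t ∧ OPair r s t.

(* A real number x ≥ 0 is the upper Dedekind cut of the positive fractions
   > x: nonempty, upward closed, without a least element.  Equal fractions
   (1/2 and 2/4, say) are not identified, but a cut cannot separate them, so
   these are the cuts of the positive rationals.  The number 0 is F itself, and
   the order is reverse inclusion. *)
Definition Cut (U F m : var) : fml :=
  Subset U F ∧ (∃ p, p ∈ U) ∧
  (∀[ p ∈ U ] ∀[ q ∈ F ] (FracLt m p q ⇒ q ∈ U)) ∧
  (∀[ p ∈ U ] ∃[ q ∈ U ] FracLt m q p).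
Definition RealLe (U V : var) : fml := Subset V U.
Definition RealLt (U V : var) : fml := RealLe U V ∧ ¬ (U ≈ V).
Definition RealAdd (F a m W U V : var) : fml :=
  ∀ r, r ∈ W ⇔ (r ∈ F ∧
    ∃[ p ∈ U ] ∃[ q ∈ V ] ∃ s, FracAdd a m s p q ∧ FracLe m s r).

(* R = [0, ∞), with F, a, m as above; F also serves as the real number 0. *)
Definition NonnegReals (R F a m : var) : fml :=
  ∃ w, Omega w ∧ Addition a w ∧ Multiplication m a w ∧ Fractions F w ∧
    ∀ U, U ∈ R ⇔ Cut U F m.

(** * Topology *)

Definition Topology (Z T : var) : fml :=
  (∀[ U ∈ T ] Subset U Z) ∧
  (∃[ e ∈ T ] Empty e) ∧
  Z ∈ T ∧
  (∀ C u, Subset C T ∧ Union u C ⇒ u ∈ T) ∧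
  (∀[ U ∈ T ] ∀[ V ∈ T ] ∀ W, (∀ x, x ∈ W ⇔ (x ∈ U ∧ x ∈ V)) ⇒ W ∈ T).

Definition Hausdorff (Z T : var) : fml :=
  ∀[ x ∈ Z ] ∀[ y ∈ Z ] (¬ (x ≈ y) ⇒
    ∃[ U ∈ T ] ∃[ V ∈ T ] (x ∈ U ∧ y ∈ V ∧ ¬ ∃ z, z ∈ U ∧ z ∈ V)).

Definition Metric (d Z R F a m : var) : fml :=
  Fun2 d Z R ∧
  (∀[ x ∈ Z ] ∀[ y ∈ Z ] (Rel2 d x y F ⇔ x ≈ y)) ∧
  (∀ x y r, Rel2 d x y r ⇒ Rel2 d y x r) ∧
  (∀ x y z r s t, Rel2 d x z r ∧ Rel2 d x y s ∧ Rel2 d y z t ⇒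
     ∃ v, RealAdd F a m v s t ∧ RealLe r v).

(* T is the topology whose open sets are the subsets U of Z containing, with
   each point, an open d-ball around it. *)
Definition MetricTopology (T d Z R F : var) : fml :=
  ∀ U, U ∈ T ⇔ (Subset U Z ∧
    ∀[ x ∈ U ] ∃[ e ∈ R ] (RealLt F e ∧
      ∀[ y ∈ Z ] ∀ r, Rel2 d x y r ∧ RealLt r e ⇒ y ∈ U)).

Definition Metrizable (Z T : var) : fml :=
  ∃ R F a m d, NonnegReals R F a m ∧ Metric d Z R F a m ∧
    MetricTopology T d Z R F.

Definition Covers (C M : var) : fml := ∀[ x ∈ M ] ∃[ U ∈ C ] x ∈ U.
Definition Compact (M Z T : var) : fml :=
  Subset M Z ∧
  ∀ C, Subset C T ∧ Covers C M ⇒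
    ∃ D, Subset D C ∧ Finite D ∧ Covers D M.

Definition CompactComplementTopology (S Z T : var) : fml :=
  ∀ U, U ∈ S ⇔ (Empty U ∨
    ∃ M, Compact M Z T ∧ ∀ x, x ∈ U ⇔ (x ∈ Z ∧ ¬ (x ∈ M))).

(* Every point has a countable base of open neighbourhoods. *)
Definition FirstCountable (Z T : var) : fml :=
  ∀[ x ∈ Z ] ∃ B, Countable B ∧
    (∀[ U ∈ B ] (U ∈ T ∧ x ∈ U)) ∧
    (∀[ V ∈ T ] (x ∈ V ⇒ ∃[ U ∈ B ] Subset U V)).

(* Main.v *)
(* By completeness it suffices to find the space in every model of ZF.  There, take
   Z to be the set of pairs (i, j) of positive natural numbers, fix the point
   c = (1, 1), give c the weight 0 and every other (i, j) the weight 1/i, and let the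
   distance of distinct points be the larger of their weights.  All points except c
   are isolated, and the neighbourhoods of c are the sets that contain c and all but
   finitely many columns {i} x N.  A compact set contains no column entirely, whereas
   a set that contains c and meets each column in at most one point is compact.

   Suppose that a point x other than c has a countable base (U_n) in the compact
   complement topology.  Each U_n meets column n + 2, say in (n + 2, j_n) with j_n
   minimal, which needs no choice.  The set K of c and these points is compact and
   misses x, so some U_n lies in Z \ K, although (n + 2, j_n) is in both U_n and K. *)

From Stdlib Require Import List Arith Lia Classical ClassicalEpsilon Ring Cantor
  FunctionalExtensionality PropExtensionality.
Require Import Defs.
Import ListNotations.

(** * Completeness of the calculus *)

(** Outside the model the logic is classical and has [epsilon]; inside it no choice may be assumed.
    Every set of the model must therefore come from an axiom, and Separation applies only to
    predicates that a formula with parameters defines. [DP] and [DT] carry this obligation through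
    the whole proof. Moreover a model may have nonstandard natural numbers, so neither [nat] nor
    lists can measure its finite sets: induction, recursion and finiteness are handled inside the
    model. The weights are chosen to keep real arithmetic small. Every nonzero distance is some 1/i,
    so these are the only cuts to be studied besides 0, and taking the larger weight gives an
    ultrametric, so a sum of reals is only ever compared with its terms. The point x is (1, 2). It
    shares column 1 with c, so the columns n + 2 contain neither of them: K misses x, and c is its
    only point in column 1. *)

Definition scons {A} (a : A) (r : nat -> A) (i : nat) : A :=
  match i with 0 => a | S k => r k end.

Lemma ren_ext p : forall r s, (forall i, r i = s i) -> ren r p = ren s p.
Proof.
  induction p; simpl; intros r s H; f_equal; auto.
  apply IHp. intros [|i]; simpl; auto.
Qed.

Lemma ren_bounded p : forall n r s, bounded n p ->
  (forall i, i < n -> r i = s i) -> ren r p = ren s p.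
Proof.
  induction p; simpl; intros n r s B H; f_equal; try tauto; try (apply H; tauto);
    try (apply IHp1 with n; tauto); try (apply IHp2 with n; tauto).
  apply (IHp (S n)); auto. intros [|i] Hi; simpl; auto. rewrite H; auto; lia.
Qed.

Lemma ren_comp p : forall r s, ren r (ren s p) = ren (fun i => r (s i)) p.
Proof.
  induction p; simpl; intros r s; f_equal; auto.
  rewrite IHp. apply ren_ext. intros [|i]; reflexivity.
Qed.

Lemma ren_id p : forall r, (forall i, r i = i) -> ren r p = p.
Proof.
  induction p; simpl; intros r H; f_equal; auto.
  apply IHp. intros [|i]; simpl; auto.
Qed.

Lemma bounded_mono p : forall n m, n <= m -> bounded n p -> bounded m p.
Proof.
  induction p; simpl; intros n m H B; try lia; auto.
  - destruct B; eauto.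
  - apply IHp with (S n); auto; lia.
Qed.

Lemma bounded_exists p : exists n, bounded n p.
Proof.
  induction p; simpl.
  1,2: exists (S (x + y)); lia.
  - exists 0; exact I.
  - destruct IHp1 as [n H], IHp2 as [m K]. exists (n + m).
    split; (eapply bounded_mono; [|eassumption]; lia).
  - destruct IHp as [n H]. exists n. eapply bounded_mono; [|eassumption]; lia.
Qed.

Lemma deriv_weaken G p : G ⊢ p -> forall H, incl G H -> H ⊢ p.
Proof.
  induction 1; intros H' I.
  - apply D_hyp; auto.
  - apply D_impI, IHderiv. intros q' [<-|Q]; simpl; auto.
  - eapply D_impE; eauto.
  - apply D_raa, IHderiv. intros q' [<-|Q]; simpl; auto.
  - apply D_allI, IHderiv. intros q Q. apply in_map_iff in Q as (q' & <- & Q).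
    apply in_map; auto.
  - apply D_allE; auto.
  - apply D_eqI.
  - eapply D_eqE; eauto.
Qed.

Lemma deriv_ren G p : G ⊢ p -> forall r, map (ren r) G ⊢ ren r p.
Proof.
  induction 1; intros r; simpl in *.
  - apply D_hyp, in_map; auto.
  - apply D_impI; auto.
  - eapply D_impE; auto.
  - apply D_raa; auto. apply (IHderiv r).
  - apply D_allI. specialize (IHderiv (up r)). rewrite map_map in *.
    erewrite map_ext; [exact IHderiv|].
    intros q. unfold shift. rewrite !ren_comp. apply ren_ext. reflexivity.
  - replace (ren r (inst x p)) with (inst (r x) (ren (up r) p)).
    + apply D_allE; auto.
    + unfold inst. rewrite !ren_comp. apply ren_ext. intros [|i]; reflexivity.
  - apply D_eqI.
  - assert (E : forall z, ren r (inst z p) = inst (r z) (ren (up r) p)).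
    { intros z. unfold inst. rewrite !ren_comp. apply ren_ext.
      intros [|i]; reflexivity. }
    rewrite E. apply D_eqE with (r x); auto. rewrite <- E; auto.
Qed.

(** The variable [y] is fresh for [G], so it may be renamed to 0 while all others move up by one. On
    [G] this renaming is [shift]; on [inst y p] it undoes the instantiation. *)
Lemma deriv_gen G p y : (forall q, In q G -> bounded y q) -> bounded (S y) p ->
  G ⊢ inst y p -> G ⊢ All p.
Proof.
  intros BG Bp H. apply D_allI.
  apply (deriv_ren _ _) with (r := fun i => if i =? y then 0 else S i) in H.
  assert (E : map (ren (fun i => if i =? y then 0 else S i)) G = map shift G).
  { apply map_ext_in. intros q Q. apply ren_bounded with y; auto.
    intros i Hi. destruct (Nat.eqb_spec i y); auto; lia. }
  rewrite E in H. unfold inst in H. rewrite ren_comp in H.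
  assert (E' : ren (fun i => if match i with 0 => y | S k => k end =? y then 0
     else S match i with 0 => y | S k => k end) p = ren (fun i => i) p).
  { apply ren_bounded with (S y); auto. intros [|i] Hi.
    - now rewrite Nat.eqb_refl.
    - destruct (Nat.eqb_spec i y); auto; lia. }
  rewrite E', ren_id in H; auto.
Qed.

Definition consistent (T : form -> Prop) : Prop :=
  ~ exists G, (forall q, In q G -> T q) /\ G ⊢ Bot.

Definition extend (T : form -> Prop) (L : list form) (q : form) : Prop :=
  T q \/ In q L.

Lemma extend_cons_split T L p G :
  (forall q, In q G -> extend T (p :: L) q) ->
  exists G', (forall q, In q G' -> extend T L q) /\ incl G (p :: G').
Proof.
  induction G as [|g G IH]; intros H.
  - exists nil. split; [intros q []|intros q []].
  - destruct IH as (G' & A & B). { intros q Q; apply H; right; auto. }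
    destruct (H g (or_introl eq_refl)) as [Hg|[<-|Hg]].
    + exists (g :: G'). split.
      * intros q [<-|Q]; auto. now left.
      * intros q [<-|Q]; simpl; auto. destruct (B q Q); auto.
    + exists G'. split; auto. intros q [<-|Q]; [now left|apply B; auto].
    + exists (g :: G'). split.
      * intros q [<-|Q]; auto. now right.
      * intros q [<-|Q]; simpl; auto. destruct (B q Q); auto.
Qed.

Lemma inconsistent_cons T L p : ~ consistent (extend T (p :: L)) ->
  exists G, (forall q, In q G -> extend T L q) /\ (p :: G) ⊢ Bot.
Proof.
  intros H. apply NNPP in H as (G & A & D).
  destruct (extend_cons_split _ _ _ _ A) as (G' & A' & I).
  exists G'. split; auto. eapply deriv_weaken; eauto.
Qed.

Fixpoint code (p : form) : nat :=
  match p with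
  | Mem x y => to_nat (0, to_nat (x, y))
  | Eql x y => to_nat (1, to_nat (x, y))
  | Bot => to_nat (2, 0)
  | Imp p q => to_nat (3, to_nat (code p, code q))
  | All p => to_nat (4, code p)
  end.

Lemma code_inj p : forall q, code p = code q -> p = q.
Proof.
  induction p; intros [] H; cbn [code] in H; apply to_nat_inj in H;
    try discriminate; try (apply (f_equal snd) in H; cbn [snd] in H);
    try apply to_nat_inj in H; try (injection H as E1 E2); f_equal; auto.
Qed.

(** * Henkin's construction and the term model *)

Section Henkin.
Variable T : form -> Prop.
Hypothesis T_closed : forall q, T q -> bounded 0 q.

(** The variables themselves serve as Henkin constants; a number above all free variables of the
    formulas added so far is a fresh one. *)
Definition bound_of (L : list form) : nat :=
  epsilon (inhabits 0) (fun n => forall q, In q L -> bounded n q).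

Lemma bound_of_spec L q : In q L -> bounded (bound_of L) q.
Proof.
  unfold bound_of. revert q. apply epsilon_spec.
  induction L as [|p L [n H]]. { exists 0; intros q []. }
  destruct (bounded_exists p) as [m K]. exists (n + m).
  intros q [<-|Q]; (eapply bounded_mono; [|eauto]; lia).
Qed.

Definition witness (p : form) (L : list form) : list form :=
  match p with
  | Imp (All q) Bot => Neg (inst (bound_of (p :: L)) q) :: p :: L
  | _ => p :: L
  end.

Lemma witness_incl p L : incl (p :: L) (witness p L).
Proof.
  unfold witness. repeat match goal with |- context [match ?x with _ => _ end] =>
    destruct x end; intros a H; simpl in *; tauto.
Qed.

(** If the witness caused an inconsistency, the other hypotheses would derive [q] at a variable that
    is free in none of them, since [T] consists of sentences. Generalisation would then give
    [All q], against [p]. *)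
Lemma witness_consistent p L : consistent (extend T (p :: L)) ->
  consistent (extend T (witness p L)).
Proof.
  intros C. destruct p as [| | |p1 p2|]; auto. destruct p1 as [| | | |q]; auto.
  destruct p2; auto. unfold witness. set (y := bound_of _). apply NNPP. intros H.
  apply inconsistent_cons in H as (G & A & D). apply C.
  exists (Imp (All q) Bot :: G). split.
  { intros q' [<-|Q]; auto. right; now left. }
  apply D_impE with (All q). { apply D_hyp; now left. }
  assert (By : forall q', extend T (Imp (All q) Bot :: L) q' -> bounded y q').
  { intros q' [Q|Q]. - eapply bounded_mono; [|eauto]; lia.
    - unfold y. apply bound_of_spec; auto. }
  apply deriv_gen with y.
  - intros q' [<-|Q]; apply By; auto. right; now left.
  - apply (By (Imp (All q) Bot)). right; now left.
  - apply D_raa. eapply deriv_weaken; eauto. intros a Ha; simpl in *; tauto.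
Qed.

(** A number that codes nothing yields an arbitrary formula. This is harmless, as a stage adds only
    what is consistent. *)
Definition decode (n : nat) : form := epsilon (inhabits Bot) (fun p => code p = n).

Lemma decode_code p : decode (code p) = p.
Proof.
  apply code_inj. unfold decode. apply epsilon_spec with (P := fun q => code q = code p).
  eauto.
Qed.

Fixpoint stage (n : nat) : list form :=
  match n with
  | 0 => nil
  | S n => if excluded_middle_informative
               (consistent (extend T (decode n :: stage n)))
           then witness (decode n) (stage n) else stage n
  end.

Lemma stage_incl n m : n <= m -> incl (stage n) (stage m).
Proof.
  induction 1; [apply incl_refl|]. eapply incl_tran; eauto. simpl.
  destruct excluded_middle_informative; [|apply incl_refl].
  eapply incl_tran; [|apply witness_incl]. apply incl_tl, incl_refl.
Qed.

Definition complete (q : form) : Prop := exists n, extend T (stage n) q.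

Hypothesis T_con : consistent T.

Lemma stage_consistent n : consistent (extend T (stage n)).
Proof.
  induction n; simpl.
  - intros (G & A & D). apply T_con. exists G. split; auto.
    intros q Q. destruct (A q Q) as [|[]]; auto.
  - destruct excluded_middle_informative; auto using witness_consistent.
Qed.

Lemma complete_finite G : (forall q, In q G -> complete q) ->
  exists n, forall q, In q G -> extend T (stage n) q.
Proof.
  induction G as [|g G IH]; intros H. { exists 0; intros q []. }
  destruct IH as [n A]. { intros q Q; apply H; now right. }
  destruct (H g (or_introl eq_refl)) as [m B]. exists (n + m).
  intros q [<-|Q].
  - destruct B; [now left|right]. eapply stage_incl; [|eauto]; lia.
  - destruct (A q Q); [now left|right]. eapply stage_incl; [|eauto]; lia.
Qed.

Lemma complete_consistent : consistent complete.
Proof.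
  intros (G & A & D). apply complete_finite in A as [n A].
  apply (stage_consistent n). eauto.
Qed.

(** The formula has its turn at stage [code p], and what is consistent with the limit is consistent
    with that stage. *)
Lemma complete_witness p : consistent (extend complete [p]) ->
  exists n, incl (witness p (stage n)) (stage (S n)).
Proof.
  intros C. exists (code p). simpl. rewrite decode_code.
  destruct excluded_middle_informative as [|N]; [apply incl_refl|].
  exfalso. apply N. intros (G & A & D). apply C. exists G. split; auto.
  intros q Q. destruct (A q Q) as [K|[<-|K]].
  - left. exists 0. now left.
  - right; now left.
  - left. exists (code p). now right.
Qed.

Lemma complete_maximal p : consistent (extend complete [p]) -> complete p.
Proof.
  intros C. destruct (complete_witness p C) as [n I]. exists (S n). right.
  apply I, witness_incl. now left.
Qed.

Lemma complete_closed G p : (forall q, In q G -> complete q) -> G ⊢ p -> complete p.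
Proof.
  intros A D. apply complete_maximal. apply NNPP. intros N.
  apply inconsistent_cons in N as (G' & A' & D').
  apply complete_consistent. exists (G ++ G'). split.
  - intros q Q. apply in_app_or in Q as [Q|Q]; auto. destruct (A' q Q) as [|[]]; auto.
  - apply D_impE with p.
    + apply D_impI. eapply deriv_weaken; eauto. intros a [<-|Ha]; simpl; auto.
      right. apply in_or_app; auto.
    + eapply deriv_weaken; eauto. apply incl_appl, incl_refl.
Qed.

Lemma complete_Neg p : ~ complete p -> complete (Neg p).
Proof.
  intros N. assert (H : ~ consistent (extend complete [p])).
  { intros C. apply N, complete_maximal, C. }
  apply inconsistent_cons in H as (G & A & D).
  apply complete_closed with G; [|apply D_impI; auto].
  intros q Q. destruct (A q Q) as [|[]]; auto.
Qed.

Lemma complete_Bot : ~ complete Bot.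
Proof.
  intros H. apply complete_consistent. exists [Bot]. split.
  - intros q [<-|[]]; auto. - apply D_hyp; now left.
Qed.

Lemma complete_Imp p q : complete (Imp p q) <-> (complete p -> complete q).
Proof.
  split.
  - intros H K. apply complete_closed with [Imp p q; p].
    + intros a [<-|[<-|[]]]; auto.
    + apply D_impE with p; apply D_hyp; simpl; auto.
  - intros H. destruct (classic (complete p)) as [K|K].
    + apply complete_closed with [q]. { intros a [<-|[]]; auto. }
      apply D_impI, D_hyp; simpl; auto.
    + apply complete_closed with [Neg p].
      { intros a [<-|[]]; auto using complete_Neg. }
      apply D_impI, D_raa. apply D_impE with p; apply D_hyp; simpl; auto.
Qed.

Lemma complete_All p : complete (All p) <-> forall y, complete (inst y p).
Proof.
  split.
  - intros H y. apply complete_closed with [All p]. { intros a [<-|[]]; auto. }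
    apply D_allE, D_hyp; simpl; auto.
  - intros H. apply NNPP. intros N. apply complete_Neg in N.
    destruct (complete_witness (Neg (All p))) as [n I].
    { intros (G & A & D). apply complete_consistent. exists G. split; auto.
      intros q Q. destruct (A q Q) as [|[<-|[]]]; auto. }
    set (y := bound_of (Neg (All p) :: stage n)).
    apply complete_Bot.
    apply complete_closed with [Neg (inst y p); inst y p].
    + intros a [<-|[<-|[]]]; auto. exists (S n). right. apply I. simpl. now left.
    + apply D_impE with (inst y p); apply D_hyp; simpl; auto.
Qed.

Lemma complete_refl x : complete (Eql x x).
Proof. apply complete_closed with nil; [intros q []|apply D_eqI]. Qed.

Lemma complete_subst x y p : complete (Eql x y) -> complete (inst x p) ->
  complete (inst y p).
Proof.
  intros H K. apply complete_closed with [Eql x y; inst x p].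
  - intros a [<-|[<-|[]]]; auto.
  - apply D_eqE with x; apply D_hyp; simpl; auto.
Qed.

Lemma complete_sym x y : complete (Eql x y) -> complete (Eql y x).
Proof.
  (* Variable 0 is the hole of the formula: its instance at [x] is [Eql x x], its instance at [y] is
     the goal. *)
  intros H. apply (complete_subst x y (Eql 0 (S x)) H), complete_refl.
Qed.

Lemma complete_trans x y z : complete (Eql x y) -> complete (Eql y z) ->
  complete (Eql x z).
Proof. intros H K. apply (complete_subst y z (Eql (S x) 0) K), H. Qed.

(** The term model is a quotient because [sat] reads [Eql] as equality in Rocq. A class is
    represented by its predicate, so that extensionality identifies equal classes. *)
Definition class (x y : nat) : Prop := complete (Eql x y).
Definition term_model : Type := {P | exists x, P = class x}.
Definition cls (x : nat) : term_model := exist _ (class x) (ex_intro _ x eq_refl).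

Lemma cls_eq x y : cls x = cls y <-> complete (Eql x y).
Proof.
  split.
  - intros H. injection H as E. change (class x y). rewrite E. apply complete_refl.
  - intros H. assert (E : class x = class y).
    { extensionality z. apply propositional_extensionality.
      split; intros K; [eapply complete_trans; [apply complete_sym|]|
                        eapply complete_trans]; eauto. }
    apply eq_sig_hprop; auto. intros; apply proof_irrelevance.
Qed.

Lemma cls_surj a : exists x, a = cls x.
Proof.
  destruct a as [P [x E]]. exists x. subst. reflexivity.
Qed.

Definition term_mem (a b : term_model) : Prop :=
  exists x y, a = cls x /\ b = cls y /\ complete (Mem x y).

Lemma term_mem_cls x y : term_mem (cls x) (cls y) <-> complete (Mem x y).
Proof.
  split; [|exists x, y; auto].
  intros (x' & y' & E & E' & H). apply cls_eq, complete_sym in E, E'.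
  apply (complete_subst x' x (Mem 0 (S y)) E).
  apply (complete_subst y' y (Mem (S x') 0) E'). exact H.
Qed.
End Henkin.

(** * Satisfaction and the completeness theorem *)

Fixpoint sat {D} (mem : D -> D -> Prop) (rho : nat -> D) (p : form) : Prop :=
  match p with
  | Mem x y => mem (rho x) (rho y)
  | Eql x y => rho x = rho y
  | Bot => False
  | Imp p q => sat mem rho p -> sat mem rho q
  | All p => forall a, sat mem (scons a rho) p
  end.

Lemma sat_ext {D} (mem : D -> D -> Prop) rho rho' p :
  (forall i, rho i = rho' i) -> sat mem rho p = sat mem rho' p.
Proof. intros H. f_equal. extensionality i. apply H. Qed.

Lemma sat_bounded {D} (mem : D -> D -> Prop) p : forall n rho rho', bounded n p ->
  (forall i, i < n -> rho i = rho' i) -> sat mem rho p <-> sat mem rho' p.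
Proof.
  induction p; simpl; intros n rho rho' B H.
  - rewrite !H by tauto. tauto.
  - rewrite !H by tauto. tauto.
  - tauto.
  - rewrite (IHp1 n rho rho'), (IHp2 n rho rho'); tauto.
  - split; intros K a; specialize (K a); revert K; apply IHp with (S n); auto;
      intros [|i] Hi; simpl; auto; first [apply H; lia | symmetry; apply H; lia].
Qed.

Lemma sat_ren {D} (mem : D -> D -> Prop) p : forall r rho,
  sat mem rho (ren r p) <-> sat mem (fun i => rho (r i)) p.
Proof.
  induction p; simpl; intros r rho; try tauto.
  - rewrite IHp1, IHp2. tauto.
  - split; intros H a; specialize (H a); [apply IHp in H|apply IHp];
      erewrite sat_ext; eauto; intros [|i]; reflexivity.
Qed.

(** The renaming [r] is general because the quantifier case substitutes a representative for the
    bound variable; every element of the term model has one. *)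
Lemma truth T (T_closed : forall q, T q -> bounded 0 q) (C : consistent T) p :
  forall r, sat (term_mem T) (fun i => cls T (r i)) p <-> complete T (ren r p).
Proof.
  induction p; simpl; intros r.
  - apply term_mem_cls; auto.
  - apply cls_eq; auto.
  - split; [tauto|]. intros H. apply complete_Bot in H; auto.
  - rewrite complete_Imp, IHp1, IHp2; auto. tauto.
  - rewrite complete_All; auto.
    assert (E : forall y, sat (term_mem T) (scons (cls T y) (fun i => cls T (r i))) p
                <-> complete T (inst y (ren (up r) p))).
    { intros y. unfold inst. rewrite ren_comp.
      rewrite (ren_ext p _ (scons y r)) by (intros [|i]; reflexivity).
      rewrite <- IHp. erewrite sat_ext; [reflexivity|]. intros [|i]; reflexivity. }
    split.
    + intros H y. apply E, H.
    + intros H a. destruct (cls_surj T a) as [y ->]. apply E, H.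
Qed.

(** If [p] were not provable, [T] with [Neg p] would be consistent, and its term model would satisfy
    [T] without satisfying [p]. *)
Theorem completeness (T : form -> Prop) (p : form) :
  (forall q, T q -> bounded 0 q) -> bounded 0 p ->
  (forall (D : Type) (mem : D -> D -> Prop) (rho : nat -> D),
     (forall q rho', T q -> sat mem rho' q) -> sat mem rho p) ->
  provable T p.
Proof.
  intros HT Hp H. apply NNPP. intros N.
  set (T' := extend T [Neg p]).
  assert (T'_closed : forall q, T' q -> bounded 0 q).
  { intros q [Q|[<-|[]]]; auto. split; auto. exact I. }
  assert (C : consistent T').
  { apply NNPP. intros K. apply inconsistent_cons in K as (G & A & D). apply N.
    exists G. split; [|apply D_raa; auto]. intros q Q. destruct (A q Q) as [|[]]; auto. }
  assert (S : forall q rho, T' q -> sat (term_mem T') rho q).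
  { intros q rho Q. apply (sat_bounded _ q 0) with (rho := fun i => cls T' i); auto.
    { intros; lia. }
    apply (truth T' T'_closed C q (fun i => i)). rewrite ren_id by auto.
    exists 0. now left. }
  apply (S (Neg p) (cls T')).
  - right; now left.
  - apply H. intros q rho Q. apply S. now left.
Qed.

(** * Satisfaction of formulas with named variables *)

Class Model := {
  D : Type;
  mem : D -> D -> Prop;
  dflt : D;
  model_ZF : forall q rho, ZF q -> sat mem rho q
}.

Declare Scope set_scope.
Delimit Scope set_scope with set.
Notation "x ∈ y" := (mem x y) (at level 70) : set_scope.
Local Open Scope set_scope.

Section Holds.
Context {M : Model}.

(* The head of [e] is the value of the variable of level [length e - 1]. *)
Definition holds (e : list D) (p : fml) : Prop :=
  sat mem (fun i => nth i e dflt) (p (length e)).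

(** [h_all] and [h_ex] name a bound variable by the length of the environment, so levels appear as
    lengths of tails of the environment. This relation finds their values by proof search, without
    arithmetic on levels. *)
Inductive Den : list D -> var -> D -> Prop :=
| Den_hd a e : Den (a :: e) (length e) a
| Den_tl a b e v : Den e v b -> Den (a :: e) v b.

Lemma Den_spec e v a : Den e v a -> v < length e /\ nth (length e - S v) e dflt = a.
Proof.
  induction 1; simpl.
  - rewrite Nat.sub_diag. split; auto.
  - destruct IHDen as [L E]. split; [lia|].
    replace (length e - v) with (S (length e - S v)) by lia. auto.
Qed.

Lemma h_mem e x y a b : Den e x a -> Den e y b -> holds e (fMem x y) <-> a ∈ b.
Proof.
  intros Hx Hy. apply Den_spec in Hx as [_ Hx], Hy as [_ Hy].
  unfold holds, fMem. simpl. now rewrite Hx, Hy.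
Qed.

Lemma h_eql e x y a b : Den e x a -> Den e y b -> holds e (fEql x y) <-> a = b.
Proof.
  intros Hx Hy. apply Den_spec in Hx as [_ Hx], Hy as [_ Hy].
  unfold holds, fEql. simpl. now rewrite Hx, Hy.
Qed.

Lemma h_neg e p P : (holds e p <-> P) -> holds e (fNeg p) <-> ~ P.
Proof. unfold holds in *. simpl. tauto. Qed.

Section Connectives.
Variables (e : list D) (p q : fml) (P Q : Prop).
Hypothesis (Hp : holds e p <-> P) (Hq : holds e q <-> Q).

Lemma h_imp : holds e (fImp p q) <-> (P -> Q).
Proof. unfold holds in *. simpl. tauto. Qed.
Lemma h_and : holds e (fAnd p q) <-> P /\ Q.
Proof. unfold holds in *. simpl. tauto. Qed.
Lemma h_or : holds e (fOr p q) <-> P \/ Q.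
Proof. unfold holds in *. simpl. tauto. Qed.
Lemma h_iff : holds e (fIff p q) <-> (P <-> Q).
Proof. unfold holds in *. simpl. tauto. Qed.
End Connectives.

Lemma holds_cons a e p :
  holds (a :: e) p = sat mem (scons a (fun i => nth i e dflt)) (p (S (length e))).
Proof. apply sat_ext. intros i. now destruct i. Qed.

Lemma h_all e (p : var -> fml) (P : D -> Prop) :
  (forall a, holds (a :: e) (p (length e)) <-> P a) ->
  holds e (fAll p) <-> forall a, P a.
Proof.
  intros H. unfold holds at 1. simpl.
  split; intros K a; specialize (K a); specialize (H a); rewrite holds_cons in H;
    apply H, K.
Qed.

Lemma h_ex e (p : var -> fml) (P : D -> Prop) :
  (forall a, holds (a :: e) (p (length e)) <-> P a) ->
  holds e (fEx p) <-> exists a, P a.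
Proof.
  intros H. unfold holds at 1. simpl. split.
  - intros K. apply NNPP. intros N. apply K. intros a Ha. apply N. exists a.
    apply H. rewrite holds_cons. exact Ha.
  - intros [a Ha] K. apply (K a). apply H in Ha. rewrite holds_cons in Ha. exact Ha.
Qed.

Lemma h_alls n : forall e (p : list var -> fml),
  holds e (fAlls n p) -> forall l : list D, length l = n ->
  holds (rev l ++ e) (p (seq (length e) n)).
Proof.
  induction n; simpl; intros e p H l L.
  - destruct l; [auto|discriminate].
  - destruct l as [|a l]; [discriminate|]. simpl. rewrite <- app_assoc. simpl.
    assert (K : holds (a :: e) (fAlls n (fun l => p (length e :: l)))).
    { rewrite holds_cons. apply H. }
    apply IHn with (l := l) in K; auto.
Qed.
End Holds.

Create HintDb den.
Create HintDb leaf.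
#[export] Hint Constructors Den : den.
Ltac den := solve [auto 100 with den nocore].
(** The meaning of a formula is read off connective by connective, so the right-hand side must
    repeat its shape; defined predicates are handled by the hints in [leaf]. *)
Ltac hs := lazymatch goal with
  | |- holds _ (fAnd _ _) <-> _ => apply h_and; hs
  | |- holds _ (fOr _ _) <-> _ => apply h_or; hs
  | |- holds _ (fImp _ _) <-> _ => apply h_imp; hs
  | |- holds _ (fIff _ _) <-> _ => apply h_iff; hs
  | |- holds _ (fNeg _) <-> _ => apply h_neg; hs
  | |- holds _ (fAll _) <-> _ => apply h_all; intro; hs
  | |- holds _ (fEx _) <-> _ => apply h_ex; intro; hs
  | |- holds _ (fMem _ _) <-> _ => apply h_mem; den
  | |- holds _ (fEql _ _) <-> _ => apply h_eql; den
  | |- _ => solve [auto 100 with leaf den nocore]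
  end.

(** * Definability with parameters *)

Section Definability.
Context {M : Model}.

Definition look (r : nat -> D) (v : nat + D) : D :=
  match v with inl k => r k | inr d => d end.

(* [s] reads each free variable of [q] as a coordinate of [r] or as a parameter. *)
Definition DP (P : (nat -> D) -> Prop) : Prop :=
  exists q (s : nat -> nat + D), forall r, P r <-> sat mem (fun i => look r (s i)) q.

(** The language has no function symbols, so an operation counts as definable through its graph,
    with the value in coordinate 0. *)
Definition DT (t : (nat -> D) -> D) : Prop :=
  DP (fun r => r 0 = t (fun i => r (S i))).

Lemma DP_ext P Q : (forall r, P r <-> Q r) -> DP P -> DP Q.
Proof.
  intros E (q & s & H). exists q, s. intros r. rewrite <- E. apply H.
Qed.

Lemma DP_subst P (s : nat -> nat + D) : DP P -> DP (fun r => P (fun i => look r (s i))).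
Proof.
  intros (q & s' & H).
  exists q, (fun i => match s' i with inl k => s k | inr d => inr d end).
  intros r. rewrite H. match goal with |- ?A <-> ?B => cut (A = B) end.
  { intros ->. tauto. }
  apply sat_ext. intros i. now destruct (s' i).
Qed.

Lemma DP_ren P f : DP P -> DP (fun r => P (fun i => r (f i))).
Proof. intros H. exact (DP_subst P (fun i => inl (f i)) H). Qed.

Lemma DP_False : DP (fun _ => False).
Proof. exists Bot, (fun i => inl i). simpl. tauto. Qed.

Lemma DP_imp P Q : DP P -> DP Q -> DP (fun r => P r -> Q r).
Proof.
  intros (q & s & H) (q' & s' & H').
  (* The two formulas come with unrelated readings of their variables. Moving them to the even and
     the odd variables lets the single reading [c] serve both. *)
  exists (Imp (ren (fun i => 2 * i) q) (ren (fun i => S (2 * i)) q')).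
  set (c := fun i => if Nat.even i then s (Nat.div2 i) else s' (Nat.div2 i)).
  assert (E : (fun i => c (2 * i)) = s).
  { extensionality i. unfold c. now rewrite Nat.even_mul, Nat.div2_double. }
  assert (E' : (fun i => c (S (2 * i))) = s').
  { extensionality i. unfold c.
    now rewrite Nat.even_succ, Nat.odd_mul, Nat.div2_succ_double. }
  exists c. intros r. cbn [sat]. rewrite !sat_ren, H, H', <- E, <- E'. tauto.
Qed.

Lemma DP_all (P : D -> (nat -> D) -> Prop) :
  DP (fun r => P (r 0) (fun i => r (S i))) -> DP (fun r => forall a, P a r).
Proof.
  intros (q & s & H).
  (* All variables that read coordinate 0 are merged into the bound variable; the others move up by
     one, and those that read coordinate [S k] now read [k]. *)
  exists (All (ren (fun i => match s i with inl 0 => 0 | _ => S i end) q)).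
  exists (fun i => match s i with inl (S k) => inl k | v => v end).
  intros r. cbn [sat].
  assert (E : forall a, sat mem (scons a (fun i =>
      look r (match s i with inl (S k) => inl k | v => v end)))
      (ren (fun i => match s i with inl 0 => 0 | _ => S i end) q) <-> P a r).
  { intros a. rewrite sat_ren, (H (scons a r)).
    match goal with |- ?A <-> ?B => cut (A = B) end; [intros ->; tauto|].
    apply sat_ext. intros i. destruct (s i) as [[|k]|d] eqn:E; simpl; now rewrite ?E. }
  split; intros K a; apply E, K.
Qed.

Lemma DP_not P : DP P -> DP (fun r => ~ P r).
Proof. intros H. exact (DP_imp P _ H DP_False). Qed.

Lemma DP_and P Q : DP P -> DP Q -> DP (fun r => P r /\ Q r).
Proof.
  intros H K. apply DP_ext with (fun r => ~ (P r -> ~ Q r)).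
  - intros r. tauto.
  - apply DP_not, DP_imp, DP_not; auto.
Qed.

Lemma DP_or P Q : DP P -> DP Q -> DP (fun r => P r \/ Q r).
Proof.
  intros H K. apply DP_ext with (fun r => ~ P r -> Q r).
  - intros r. tauto.
  - apply DP_imp; auto. apply DP_not; auto.
Qed.

Lemma DP_iff P Q : DP P -> DP Q -> DP (fun r => P r <-> Q r).
Proof. intros H K. apply DP_and; apply DP_imp; auto. Qed.

Lemma DP_ex (P : D -> (nat -> D) -> Prop) :
  DP (fun r => P (r 0) (fun i => r (S i))) -> DP (fun r => exists a, P a r).
Proof.
  intros H. apply DP_ext with (fun r => ~ forall a, ~ P a r).
  - intros r. split; [|firstorder]. intros K. apply NNPP. firstorder.
  - apply DP_not, DP_all, DP_not, H.
Qed.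

Lemma DT_var k : DT (fun r => r k).
Proof.
  exists (Eql 0 1), (fun i => match i with 0 => inl 0 | _ => inl (S k) end).
  simpl. tauto.
Qed.

Lemma DT_const a : DT (fun _ => a).
Proof.
  exists (Eql 0 1), (fun i => match i with 0 => inl 0 | _ => inr a end).
  simpl. tauto.
Qed.

Lemma DT_ren t f : DT t -> DT (fun r => t (fun i => r (f i))).
Proof.
  intros H. exact (DP_ren _ (fun i => match i with 0 => 0 | S k => S (f k) end) H).
Qed.

Lemma DP_sub1 (P : D -> (nat -> D) -> Prop) t : DT t ->
  DP (fun r => P (r 0) (fun i => r (S i))) -> DP (fun r => P (t r) r).
Proof.
  intros Ht HP. apply DP_ext with (fun r => exists a, a = t r /\ P a r).
  - intros r. split; [intros (a & -> & H); auto|eauto].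
  - apply DP_ex, DP_and; auto.
Qed.

Lemma DP_sub2 (P : D -> D -> Prop) t s : DT t -> DT s ->
  DP (fun r => P (r 0) (r 1)) -> DP (fun r => P (t r) (s r)).
Proof.
  intros Ht Hs HP. apply (DP_sub1 (fun a r => P a (s r))); auto.
  apply (DP_sub1 (fun b r => P (r 0) b) (fun r => s (fun i => r (S i)))).
  - apply DT_ren; auto.
  - apply (DP_ren _ (fun i => match i with 0 => 1 | _ => 0 end) HP).
Qed.

Lemma DP_sub3 (P : D -> D -> D -> Prop) t s u : DT t -> DT s -> DT u ->
  DP (fun r => P (r 0) (r 1) (r 2)) -> DP (fun r => P (t r) (s r) (u r)).
Proof.
  intros Ht Hs Hu HP. apply (DP_sub1 (fun a r => P a (s r) (u r))); auto.
  apply (DP_sub1 (fun b r => P (r 0) b (u (fun i => r (S i)))) (fun r => s (fun i => r (S i)))).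
  { apply DT_ren; auto. }
  apply (DP_sub1 (fun c r => P (r 1) (r 0) c) (fun r => u (fun i => r (S (S i))))).
  - apply (DT_ren u (fun i => S (S i))); auto.
  - apply (DP_ren _ (fun i => match i with 0 => 2 | 1 => 1 | _ => 0 end) HP).
Qed.

Lemma DP_mem t s : DT t -> DT s -> DP (fun r => t r ∈ s r).
Proof.
  intros Ht Hs. apply (DP_sub2 mem); auto.
  exists (Mem 0 1), inl. simpl. tauto.
Qed.

Lemma DP_eq t s : DT t -> DT s -> DP (fun r => t r = s r).
Proof.
  intros Ht Hs. apply (DP_sub2 eq); auto.
  exists (Eql 0 1), inl. simpl. tauto.
Qed.

Lemma DT_intro (t : (nat -> D) -> D) (P : D -> (nat -> D) -> Prop) :
  (forall r a, P a r <-> a = t r) -> DP (fun r => P (r 0) (fun i => r (S i))) -> DT t.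
Proof. intros E. apply DP_ext. intros r. apply E. Qed.

Lemma DT_app1 (f : D -> D) t : DT (fun r => f (r 0)) -> DT t -> DT (fun r => f (t r)).
Proof.
  intros Hf Ht. unfold DT in *.
  apply (DP_sub2 (fun b c => b = f c) (fun r => r 0) (fun r => t (fun i => r (S i)))); auto.
  - apply DT_var. - apply DT_ren; auto.
Qed.

Lemma DT_app2 (f : D -> D -> D) t s : DT (fun r => f (r 0) (r 1)) -> DT t -> DT s ->
  DT (fun r => f (t r) (s r)).
Proof.
  intros Hf Ht Hs. unfold DT in *.
  apply (DP_sub3 (fun b c d => b = f c d) (fun r => r 0) (fun r => t (fun i => r (S i)))
     (fun r => s (fun i => r (S i)))); auto; try (apply DT_ren; auto).
  apply DT_var.
Qed.

(** Freezing all coordinates but the first as parameters makes [in_sep] applicable to predicates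
    that depend on further variables. *)
Lemma DP_at P r0 : DP P -> DP (fun r => P (scons (r 0) r0)).
Proof.
  intros H. apply DP_ext with (2 := DP_subst P
    (fun i => match i with 0 => inl 0 | S k => inr (r0 k) end) H).
  intros r. replace (fun i => _) with (scons (r 0) r0); [tauto|].
  extensionality i. now destruct i.
Qed.
End Definability.

Create HintDb dp.
Ltac dp_ren := match goal with
  | H : DT ?t |- DT (fun r => ?t (fun i => r (@?f i))) => exact (DT_ren t f H)
  | H : DT ?t |- DT (fun r => ?t r) => exact H
  | H : DT (fun r => ?f (r 0)) |- DT (fun r => ?f (@?t r)) => apply (DT_app1 f t H)
  | H : DT (fun r => ?f (r 0) (r 1)) |- DT (fun r => ?f (@?t r) (@?s r)) =>
      apply (DT_app2 f t s H)
  end.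
Ltac dp_sub := match goal with
  | H : DP (fun r => ?Q (r 0) (r 1)) |- DP (fun r => ?Q (@?t r) (@?s r)) =>
      apply (DP_sub2 Q t s)
  end.
Ltac dp := cbv beta; lazymatch goal with
  | |- DP (fun r => exists a, _) => eapply DP_ex; dp
  | |- DP (fun r => _ /\ _) => apply DP_and; dp
  | |- DP (fun r => _ \/ _) => apply DP_or; dp
  | |- DP (fun r => _ <-> _) => apply DP_iff; dp
  | |- DP (fun r => ~ _) => apply DP_not; dp
  | |- DP (fun r => False) => apply DP_False
  | |- DP (fun r => forall a : D, _) => eapply DP_all; dp
  | |- DP (fun r => _ -> _) => apply DP_imp; dp
  | |- DP (fun r => mem _ _) => apply DP_mem; dp
  | |- DP (fun r => _ = _ :> D) => apply DP_eq; dp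
  | |- DT _ => first [exact (DT_var _) | exact (DT_const _) | assumption | dp_ren; dp |
    solve [auto 1 with dp nocore]]
  | |- _ => first [assumption | dp_sub; dp | solve [auto 1 with dp nocore]]
  end.

(** * The axioms in a model *)

Section Set_axioms.
Context {M : Model}.

Lemma axiom_holds p P : ZF (sentence p) -> (holds nil p <-> P) -> P.
Proof. intros H E. apply E. exact (model_ZF _ _ H). Qed.

Lemma ext a b : (forall z, z ∈ a <-> z ∈ b) -> a = b.
Proof. revert a b. eapply axiom_holds; [apply ZF_ext|hs]. Qed.

Lemma foundation a : (exists y, y ∈ a) -> exists y, y ∈ a /\ ~ exists z, z ∈ a /\ z ∈ y.
Proof. revert a. eapply axiom_holds; [apply ZF_found|hs]. Qed.

(** Names the sets that the axioms provide. The element is picked outside the model, which gives no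
    choice function inside it. *)
Definition the (P : D -> Prop) : D := epsilon (inhabits dflt) P.
Lemma the_spec (P : D -> Prop) : (exists a, P a) -> P (the P).
Proof. apply epsilon_spec. Qed.

Definition upair x y := the (fun p => forall z, z ∈ p <-> z = x \/ z = y).
Lemma in_upair x y z : z ∈ upair x y <-> z = x \/ z = y.
Proof.
  revert z. unfold upair. apply the_spec. revert x y.
  eapply axiom_holds; [apply ZF_pair|unfold UPair; hs].
Qed.

Definition bigcup c := the (fun u => forall x, x ∈ u <-> exists y, y ∈ c /\ x ∈ y).
Lemma in_bigcup c x : x ∈ bigcup c <-> exists y, y ∈ c /\ x ∈ y.
Proof.
  revert x. unfold bigcup. apply the_spec. revert c.
  eapply axiom_holds; [apply ZF_union|unfold Union; hs].
Qed.

Definition sub a b := forall z, z ∈ a -> z ∈ b.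
Definition power a := the (fun u => forall x, x ∈ u <-> sub x a).
Lemma in_power a x : x ∈ power a <-> sub x a.
Proof.
  revert x. unfold power. apply the_spec. revert a.
  eapply axiom_holds; [apply ZF_power|unfold Subset, sub; hs].
Qed.

Lemma separation q rho a : exists b, forall x, x ∈ b <-> x ∈ a /\ sat mem (scons x rho) q.
Proof.
  destruct (bounded_exists q) as [n B].
  pose proof (ZF_sep n q (bounded_mono q n (S n) ltac:(lia) B)) as H.
  apply (model_ZF _ (fun i => nth i nil dflt)) in H.
  (* The bound [n] on the free variables of [q] makes the first [n] values of [rho] sufficient as
     parameters of the instance. *)
  set (l := map rho (seq 0 n)).
  assert (L : length l = n) by (unfold l; now rewrite length_map, length_seq).
  apply (h_alls n nil) with (l := l) in H; auto.
  rewrite app_nil_r in H. revert a. cbn [length] in H.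
  revert H. apply h_all. intros a. apply h_ex. intros b. apply h_all. intros x.
  apply h_iff. { apply h_mem; den. }
  apply h_and. { apply h_mem; den. }
  unfold holds, fApp. rewrite sat_ren. cbn [length]. rewrite length_rev, L.
  apply sat_bounded with (S n). { eapply bounded_mono; [|eassumption]; lia. }
  intros i Hi. destruct i as [|i]; cbn [nth scons].
  - now rewrite Nat.sub_diag.
  - rewrite seq_nth by lia. replace (S (S (S n)) - S (0 + i)) with (S (S (S (n - S i)))) by lia.
    cbn [nth]. rewrite rev_nth by lia. rewrite L.
    replace (n - S (n - S i)) with i by lia. unfold l.
    rewrite (nth_indep _ _ (rho 0)) by (rewrite length_map, length_seq; lia).
    rewrite map_nth. f_equal. rewrite seq_nth; lia.
Qed.

Definition sep a (P : D -> Prop) := the (fun b => forall x, x ∈ b <-> x ∈ a /\ P x).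
Lemma in_sep a P x : DP (fun r => P (r 0)) -> x ∈ sep a P <-> x ∈ a /\ P x.
Proof.
  intros (q & s & H). revert x. unfold sep. apply the_spec.
  (* [H] is going to be used at the constant sequence [x], so every coordinate may be read as
     variable 0, the element under test. *)
  destruct (separation (ren (fun i => match s i with inl _ => 0 | _ => S i end) q)
    (fun i => match s i with inr d => d | inl _ => a end) a) as [b Hb].
  exists b. intros x. rewrite Hb, sat_ren, (H (fun _ => x)).
  match goal with |- _ /\ ?A <-> _ /\ ?B => cut (A = B) end; [intros ->; tauto|].
  apply sat_ext. intros i. destruct (s i) as [k|d] eqn:E; simpl; now rewrite ?E.
Qed.

Lemma DT_sep t (P : D -> (nat -> D) -> Prop) : DT t ->
  DP (fun r => P (r 0) (fun i => r (S i))) -> DT (fun r => sep (t r) (fun x => P x r)).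
Proof.
  intros Ht HP.
  apply DT_intro with (fun a r => forall x, x ∈ a <-> x ∈ t r /\ P x r).
  - intros r a.
    assert (E : forall x, x ∈ sep (t r) (fun x => P x r) <-> x ∈ t r /\ P x r).
    { intros x. apply (in_sep (t r) (fun x => P x r)), (DP_at _ r HP). }
    split; [|intros ->; apply E]. intros K. apply ext. intros z. now rewrite K, E.
  - apply DP_all, DP_iff; [dp|apply DP_and; [dp|]].
    (* Coordinate 1 now holds the candidate set, so the parameters of [P] are read from coordinate 2
       on. *)
    exact (DP_ren _ (fun i => match i with 0 => 0 | S k => S (S k) end) HP).
Qed.

Lemma DT_upair t s : DT t -> DT s -> DT (fun r => upair (t r) (s r)).
Proof.
  intros Ht Hs.
  apply DT_intro with (fun a r => forall x, x ∈ a <-> x = t r \/ x = s r); [|dp].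
  intros r a. split; [|intros -> x; apply in_upair].
  intros K. apply ext. intros z. now rewrite K, in_upair.
Qed.

Lemma DT_bigcup t : DT t -> DT (fun r => bigcup (t r)).
Proof.
  intros Ht.
  apply DT_intro with (fun a r => forall x, x ∈ a <-> exists y, y ∈ t r /\ x ∈ y); [|dp].
  intros r a. split; [|intros -> x; apply in_bigcup].
  intros K. apply ext. intros z. now rewrite K, in_bigcup.
Qed.

Lemma DP_sub t s : DT t -> DT s -> DP (fun r => sub (t r) (s r)).
Proof. intros. unfold sub. dp. Qed.

Lemma DT_power t : DT t -> DT (fun r => power (t r)).
Proof.
  intros Ht.
  apply DT_intro with (fun a r => forall x, x ∈ a <-> sub x (t r));
    [|apply DP_all, DP_iff; [dp|apply DP_sub; dp]].
  intros r a. split; [|intros -> x; apply in_power].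
  intros K. apply ext. intros z. now rewrite K, in_power.
Qed.
End Set_axioms.
#[export] Hint Extern 0 (DP (fun r => sub _ _)) => apply DP_sub; dp : dp.
#[export] Hint Extern 0 (DT (fun r => upair _ _)) => apply DT_upair; dp : dp.
#[export] Hint Extern 0 (DT (fun r => bigcup _)) => apply DT_bigcup; dp : dp.
#[export] Hint Extern 0 (DT (fun r => power _)) => apply DT_power; dp : dp.
#[export] Hint Extern 0 (DT (fun r => sep _ _)) => apply DT_sep; dp : dp.

(** * Basic set operations *)

Section Sets.
Context {M : Model}.

Definition emp := sep dflt (fun _ => False).
Lemma in_emp x : ~ x ∈ emp.
Proof. unfold emp. rewrite in_sep by dp. tauto. Qed.
Lemma emp_ext x : (forall y, ~ y ∈ x) -> x = emp.
Proof. intros H. apply ext. intros z. pose proof (in_emp z). firstorder. Qed.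

Definition opair x y := upair (upair x x) (upair x y).
Lemma DT_opair t s : DT t -> DT s -> DT (fun r => opair (t r) (s r)).
Proof. intros. unfold opair. dp. Qed.

Lemma upair_inj x y x' y' : upair x y = upair x' y' ->
  x = x' /\ y = y' \/ x = y' /\ y = x'.
Proof.
  intros E.
  assert (K : forall z, z = x \/ z = y <-> z = x' \/ z = y').
  { intros z. now rewrite <- !in_upair, E. }
  pose proof (proj1 (K x) (or_introl eq_refl)).
  pose proof (proj1 (K y) (or_intror eq_refl)).
  pose proof (proj2 (K x') (or_introl eq_refl)).
  pose proof (proj2 (K y') (or_intror eq_refl)).
  intuition congruence.
Qed.

Lemma opair_inj x y x' y' : opair x y = opair x' y' -> x = x' /\ y = y'.
Proof.
  intros E. apply upair_inj in E as [[E F]|[E F]];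
    apply upair_inj in E; apply upair_inj in F; intuition congruence.
Qed.

Definition union2 a b := bigcup (upair a b).
Lemma in_union2 a b x : x ∈ union2 a b <-> x ∈ a \/ x ∈ b.
Proof.
  unfold union2. rewrite in_bigcup. split.
  - intros (y & H & K). apply in_upair in H as [->| ->]; auto.
  - intros [H|H]; [exists a|exists b]; rewrite in_upair; auto.
Qed.
Lemma DT_union2 t s : DT t -> DT s -> DT (fun r => union2 (t r) (s r)).
Proof. intros. unfold union2. dp. Qed.

Definition succ x := union2 x (upair x x).
Lemma in_succ x z : z ∈ succ x <-> z ∈ x \/ z = x.
Proof. unfold succ. rewrite in_union2, in_upair. tauto. Qed.
End Sets.
#[export] Hint Extern 0 (DT (fun r => opair _ _)) => apply DT_opair; dp : dp.
#[export] Hint Extern 0 (DT (fun r => union2 _ _)) => apply DT_union2; dp : dp.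

Section Sets2.
Context {M : Model}.
Lemma DT_succ t : DT t -> DT (fun r => succ (t r)).
Proof. intros. unfold succ. dp. Qed.

(** A Kuratowski pair is a set of subsets of the union, so Separation from a double power set yields
    the product. *)
Definition prod A B := sep (power (power (union2 A B)))
  (fun p => exists x, x ∈ A /\ exists y, y ∈ B /\ p = opair x y).
Lemma mem_prod A B p :
  p ∈ prod A B <-> exists x, x ∈ A /\ exists y, y ∈ B /\ p = opair x y.
Proof.
  unfold prod. rewrite in_sep by dp. split; [tauto|]. intros H; split; auto.
  destruct H as (x & Hx & y & Hy & ->). rewrite in_power. intros z Hz.
  rewrite in_power. intros t Ht. rewrite in_union2.
  apply in_upair in Hz as [->| ->]; apply in_upair in Ht as [->| ->]; auto.
Qed.
Lemma opair_in_prod A B x y : opair x y ∈ prod A B <-> x ∈ A /\ y ∈ B.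
Proof.
  rewrite mem_prod. split; [|intros [? ?]; eauto 6].
  intros (x' & H & y' & K & E). apply opair_inj in E as [-> ->]. auto.
Qed.
End Sets2.
Lemma DT_prod {M : Model} t s : DT t -> DT s -> DT (fun r => prod (t r) (s r)).
Proof. intros. unfold prod. dp. Qed.
#[export] Hint Extern 0 (DT (fun r => succ _)) => apply DT_succ; dp : dp.
#[export] Hint Extern 0 (DT (fun r => prod _ _)) => apply DT_prod; dp : dp.

(** * The basic set-theoretic abbreviations read in a model *)

Section Reflect.
Context {M : Model}.
Variable e : list D.

Lemma h_Empty x a : Den e x a -> holds e (Empty x) <-> a = emp.
Proof.
  intros H. assert (K : holds e (Empty x) <-> ~ exists y, y ∈ a) by (unfold Empty; hs).
  rewrite K. split.
  - intros N. apply emp_ext. firstorder.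
  - intros -> [y Hy]. apply in_emp in Hy; auto.
Qed.

Lemma h_Subset x y a b : Den e x a -> Den e y b -> holds e (Subset x y) <-> sub a b.
Proof. intros. unfold Subset, sub. hs. Qed.

Lemma h_Succ x y a b : Den e x a -> Den e y b -> holds e (Succ x y) <-> a = succ b.
Proof.
  intros. transitivity (forall z, z ∈ a <-> z ∈ b \/ z = b); [unfold Succ; hs|].
  split; [|intros -> z; apply in_succ]. intros K. apply ext. intros z.
  now rewrite K, in_succ.
Qed.

Lemma h_UPair x y z a b c : Den e x a -> Den e y b -> Den e z c ->
  holds e (UPair x y z) <-> a = upair b c.
Proof.
  intros. transitivity (forall z, z ∈ a <-> z = b \/ z = c); [unfold UPair; hs|].
  split; [|intros -> t; apply in_upair]. intros K. apply ext. intros t.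
  now rewrite K, in_upair.
Qed.

Lemma h_Union x y a b : Den e x a -> Den e y b ->
  holds e (Union x y) <-> a = bigcup b.
Proof.
  intros. transitivity (forall x, x ∈ a <-> exists y, y ∈ b /\ x ∈ y); [unfold Union; hs|].
  split; [|intros -> t; apply in_bigcup]. intros K. apply ext. intros t.
  now rewrite K, in_bigcup.
Qed.
End Reflect.
#[export] Hint Resolve h_Empty h_Subset h_Succ h_UPair h_Union : leaf.

Section Reflect2.
Context {M : Model}.
Lemma h_OPair e x y z a b c : Den e x a -> Den e y b -> Den e z c ->
  holds e (OPair x y z) <-> a = opair b c.
Proof.
  intros. transitivity (exists u v, u = upair b b /\ v = upair b c /\ a = upair u v).
  - unfold OPair; hs.
  - split; [intros (u & v & -> & -> & ->); reflexivity|].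
    intros ->. exists (upair b b), (upair b c). auto.
Qed.
End Reflect2.
#[export] Hint Resolve h_OPair : leaf.

Section Reflect3.
Context {M : Model}.
Lemma h_Rel e f x y a b c : Den e f a -> Den e x b -> Den e y c ->
  holds e (Rel f x y) <-> opair b c ∈ a.
Proof.
  intros. transitivity (exists p, p ∈ a /\ p = opair b c); [unfold Rel; hs|].
  split; [intros (p & ? & ->); auto|eauto].
Qed.

Lemma h_Prod e P A B p a b : Den e P p -> Den e A a -> Den e B b ->
  holds e (Prod P A B) <-> p = prod a b.
Proof.
  intros. transitivity (forall q, q ∈ p <-> exists x, x ∈ a /\ exists y, y ∈ b /\ q = opair
    x y);
    [unfold Prod; hs|].
  split; [|intros -> t; apply mem_prod]. intros K. apply ext. intros t.
  now rewrite K, mem_prod.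
Qed.
End Reflect3.
#[export] Hint Resolve h_Rel h_Prod : leaf.

Section Reflect4.
Context {M : Model}.
Lemma h_Rel2 e f x y z a b c d : Den e f a -> Den e x b -> Den e y c -> Den e z d ->
  holds e (Rel2 f x y z) <-> opair (opair b c) d ∈ a.
Proof.
  intros. transitivity (exists p, p = opair b c /\ opair p d ∈ a); [unfold Rel2; hs|].
  split; [intros (p & -> & ?); auto|eauto].
Qed.
End Reflect4.
#[export] Hint Resolve h_Rel2 : leaf.

(** * The notions of the statement in a model *)

(* [sX] is the meaning of the formula [X] in a model, as [h_X] states. *)

Section Shallow.
Context {M : Model}.

Definition sInductive w :=
  (exists e, e ∈ w /\ e = emp) /\ forall x, x ∈ w -> exists s, s ∈ w /\ s = succ x.

Lemma h_Inductive_ e v0 w : Den e v0 w ->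
  holds e (Inductive_ v0) <-> sInductive w.
Proof. intros. unfold Inductive_, sInductive. hs. Qed.
#[local] Hint Resolve h_Inductive_ : leaf.

Definition sFun f A B :=
  (forall p, p ∈ f -> exists x, x ∈ A /\ exists y, y ∈ B /\ p = opair x y) /\
  (forall x, x ∈ A -> exists y, opair x y ∈ f) /\
  (forall x y z, opair x y ∈ f /\ opair x z ∈ f -> y = z).

Lemma h_Fun e v0 v1 v2 f A B : Den e v0 f -> Den e v1 A -> Den e v2 B ->
  holds e (Fun v0 v1 v2) <-> sFun f A B.
Proof. intros. unfold Fun, sFun. hs. Qed.
#[local] Hint Resolve h_Fun : leaf.

Definition sFun2 f A B :=
  exists P, P = prod A A /\ sFun f P B.

Lemma h_Fun2 e v0 v1 v2 f A B : Den e v0 f -> Den e v1 A -> Den e v2 B ->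
  holds e (Fun2 v0 v1 v2) <-> sFun2 f A B.
Proof. intros. unfold Fun2, sFun2. hs. Qed.
#[local] Hint Resolve h_Fun2 : leaf.

Definition sInjection f A B :=
  sFun f A B /\ forall x y z, opair x z ∈ f /\ opair y z ∈ f -> x = y.

Lemma h_Injection e v0 v1 v2 f A B : Den e v0 f -> Den e v1 A -> Den e v2 B ->
  holds e (Injection v0 v1 v2) <-> sInjection f A B.
Proof. intros. unfold Injection, sInjection. hs. Qed.
#[local] Hint Resolve h_Injection : leaf.

Definition sBijection f A B :=
  sInjection f A B /\ forall y, y ∈ B -> exists x, opair x y ∈ f.

Lemma h_Bijection e v0 v1 v2 f A B : Den e v0 f -> Den e v1 A -> Den e v2 B ->
  holds e (Bijection v0 v1 v2) <-> sBijection f A B.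
Proof. intros. unfold Bijection, sBijection. hs. Qed.
#[local] Hint Resolve h_Bijection : leaf.

Definition sOmega w :=
  sInductive w /\ forall v, sInductive v -> sub w v.

Lemma h_Omega e v0 w : Den e v0 w ->
  holds e (Omega v0) <-> sOmega w.
Proof. intros. unfold Omega, sOmega. hs. Qed.
#[local] Hint Resolve h_Omega : leaf.

Definition sCountable A :=
  exists w f, sOmega w /\ sInjection f A w.

Lemma h_Countable e v0 A : Den e v0 A ->
  holds e (Countable v0) <-> sCountable A.
Proof. intros. unfold Countable, sCountable. hs. Qed.
#[local] Hint Resolve h_Countable : leaf.

Definition sFinite A :=
  exists w n f, sOmega w /\ n ∈ w /\ sBijection f A n.

Lemma h_Finite e v0 A : Den e v0 A ->
  holds e (Finite v0) <-> sFinite A.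
Proof. intros. unfold Finite, sFinite. hs. Qed.
#[local] Hint Resolve h_Finite : leaf.

Definition sAddition a w :=
  sFun2 a w w /\
  (forall x, x ∈ w -> forall e, e = emp -> opair (opair x e) x ∈ a) /\
  (forall x y z s t, opair (opair x y) z ∈ a /\ s = succ y /\ t = succ z ->
     opair (opair x s) t ∈ a).

Lemma h_Addition e v0 v1 a w : Den e v0 a -> Den e v1 w ->
  holds e (Addition v0 v1) <-> sAddition a w.
Proof. intros. unfold Addition, sAddition. hs. Qed.
#[local] Hint Resolve h_Addition : leaf.

Definition sMultiplication m a w :=
  sFun2 m w w /\
  (forall x, x ∈ w -> forall e, e = emp -> opair (opair x e) e ∈ m) /\
  (forall x y z s t, opair (opair x y) z ∈ m /\ s = succ y /\ opair (opair z x) t ∈ a ->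
     opair (opair x s) t ∈ m).

Lemma h_Multiplication e v0 v1 v2 m a w : Den e v0 m -> Den e v1 a -> Den e v2 w ->
  holds e (Multiplication v0 v1 v2) <-> sMultiplication m a w.
Proof. intros. unfold Multiplication, sMultiplication. hs. Qed.
#[local] Hint Resolve h_Multiplication : leaf.

Definition sFractions F w :=
  forall p, p ∈ F <-> exists i, i ∈ w /\ exists j, j ∈ w /\ (~ i = emp /\ ~ j = emp /\ p =
    opair i j).

Lemma h_Fractions e v0 v1 F w : Den e v0 F -> Den e v1 w ->
  holds e (Fractions v0 v1) <-> sFractions F w.
Proof. intros. unfold Fractions, sFractions. hs. Qed.
#[local] Hint Resolve h_Fractions : leaf.

Definition sFracLt m p q :=
  exists i j k l u v, p = opair i j /\ q = opair k l /\
  opair (opair i l) u ∈ m /\ opair (opair k j) v ∈ m /\ u ∈ v.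

Lemma h_FracLt e v0 v1 v2 m p q : Den e v0 m -> Den e v1 p -> Den e v2 q ->
  holds e (FracLt v0 v1 v2) <-> sFracLt m p q.
Proof. intros. unfold FracLt, sFracLt. hs. Qed.
#[local] Hint Resolve h_FracLt : leaf.

Definition sFracLe m p q :=
  ~ sFracLt m q p.

Lemma h_FracLe e v0 v1 v2 m p q : Den e v0 m -> Den e v1 p -> Den e v2 q ->
  holds e (FracLe v0 v1 v2) <-> sFracLe m p q.
Proof. intros. unfold FracLe, sFracLe. hs. Qed.
#[local] Hint Resolve h_FracLe : leaf.

Definition sFracAdd a m r p q :=
  exists i j k l u v s t, p = opair i j /\ q = opair k l /\
  opair (opair i l) u ∈ m /\ opair (opair k j) v ∈ m /\ opair (opair u v) s ∈ a /\
  opair (opair j l) t ∈ m /\ r = opair s t.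

Lemma h_FracAdd e v0 v1 v2 v3 v4 a m r p q : Den e v0 a -> Den e v1 m -> Den e v2 r -> Den e
  v3 p -> Den e v4 q ->
  holds e (FracAdd v0 v1 v2 v3 v4) <-> sFracAdd a m r p q.
Proof. intros. unfold FracAdd, sFracAdd. hs. Qed.
#[local] Hint Resolve h_FracAdd : leaf.

Definition sCut U F m :=
  sub U F /\ (exists p, p ∈ U) /\
  (forall p, p ∈ U -> forall q, q ∈ F -> sFracLt m p q -> q ∈ U) /\
  (forall p, p ∈ U -> exists q, q ∈ U /\ sFracLt m q p).

Lemma h_Cut e v0 v1 v2 U F m : Den e v0 U -> Den e v1 F -> Den e v2 m ->
  holds e (Cut v0 v1 v2) <-> sCut U F m.
Proof. intros. unfold Cut, sCut. hs. Qed.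
#[local] Hint Resolve h_Cut : leaf.

Definition sRealLe U V :=
  sub V U.

Lemma h_RealLe e v0 v1 U V : Den e v0 U -> Den e v1 V ->
  holds e (RealLe v0 v1) <-> sRealLe U V.
Proof. intros. unfold RealLe, sRealLe. hs. Qed.
#[local] Hint Resolve h_RealLe : leaf.

Definition sRealLt U V :=
  sRealLe U V /\ ~ U = V.

Lemma h_RealLt e v0 v1 U V : Den e v0 U -> Den e v1 V ->
  holds e (RealLt v0 v1) <-> sRealLt U V.
Proof. intros. unfold RealLt, sRealLt. hs. Qed.
#[local] Hint Resolve h_RealLt : leaf.

Definition sRealAdd F a m W U V :=
  forall r, r ∈ W <-> (r ∈ F /\
  exists p, p ∈ U /\ exists q, q ∈ V /\ exists s, sFracAdd a m s p q /\ sFracLe m s r).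

Lemma h_RealAdd e v0 v1 v2 v3 v4 v5 F a m W U V : Den e v0 F -> Den e v1 a -> Den e v2 m ->
  Den e v3 W -> Den e v4 U -> Den e v5 V ->
  holds e (RealAdd v0 v1 v2 v3 v4 v5) <-> sRealAdd F a m W U V.
Proof. intros. unfold RealAdd, sRealAdd. hs. Qed.
#[local] Hint Resolve h_RealAdd : leaf.

Definition sNonnegReals R F a m :=
  exists w, sOmega w /\ sAddition a w /\ sMultiplication m a w /\ sFractions F w /\
  forall U, U ∈ R <-> sCut U F m.

Lemma h_NonnegReals e v0 v1 v2 v3 R F a m : Den e v0 R -> Den e v1 F -> Den e v2 a -> Den e
  v3 m ->
  holds e (NonnegReals v0 v1 v2 v3) <-> sNonnegReals R F a m.
Proof. intros. unfold NonnegReals, sNonnegReals. hs. Qed.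
#[local] Hint Resolve h_NonnegReals : leaf.

Definition sTopology Z T :=
  (forall U, U ∈ T -> sub U Z) /\ (exists e, e ∈ T /\ e = emp) /\ Z ∈ T /\
  (forall C u, sub C T /\ u = bigcup C -> u ∈ T) /\
  (forall U, U ∈ T -> forall V, V ∈ T -> forall W, (forall x, x ∈ W <-> x ∈ U /\ x ∈ V) -> W
    ∈ T).

Lemma h_Topology e v0 v1 Z T : Den e v0 Z -> Den e v1 T ->
  holds e (Topology v0 v1) <-> sTopology Z T.
Proof. intros. unfold Topology, sTopology. hs. Qed.
#[local] Hint Resolve h_Topology : leaf.

Definition sHausdorff Z T :=
  forall x, x ∈ Z -> forall y, y ∈ Z -> ~ x = y ->
  exists U, U ∈ T /\ exists V, V ∈ T /\ (x ∈ U /\ y ∈ V /\ ~ exists z, z ∈ U /\ z ∈ V).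

Lemma h_Hausdorff e v0 v1 Z T : Den e v0 Z -> Den e v1 T ->
  holds e (Hausdorff v0 v1) <-> sHausdorff Z T.
Proof. intros. unfold Hausdorff, sHausdorff. hs. Qed.
#[local] Hint Resolve h_Hausdorff : leaf.

Definition sMetric d Z R F a m :=
  sFun2 d Z R /\
  (forall x, x ∈ Z -> forall y, y ∈ Z -> (opair (opair x y) F ∈ d <-> x = y)) /\
  (forall x y r, opair (opair x y) r ∈ d -> opair (opair y x) r ∈ d) /\
  (forall x y z r s t, opair (opair x z) r ∈ d /\ opair (opair x y) s ∈ d /\
     opair (opair y z) t ∈ d -> exists v, sRealAdd F a m v s t /\ sRealLe r v).

Lemma h_Metric e v0 v1 v2 v3 v4 v5 d Z R F a m : Den e v0 d -> Den e v1 Z -> Den e v2 R ->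
  Den e v3 F -> Den e v4 a -> Den e v5 m ->
  holds e (Metric v0 v1 v2 v3 v4 v5) <-> sMetric d Z R F a m.
Proof. intros. unfold Metric, sMetric. hs. Qed.
#[local] Hint Resolve h_Metric : leaf.

Definition sMetricTopology T d Z R F :=
  forall U, U ∈ T <-> (sub U Z /\
  forall x, x ∈ U -> exists e, e ∈ R /\ (sRealLt F e /\
    forall y, y ∈ Z -> forall r, opair (opair x y) r ∈ d /\ sRealLt r e -> y ∈ U)).

Lemma h_MetricTopology e v0 v1 v2 v3 v4 T d Z R F : Den e v0 T -> Den e v1 d -> Den e v2 Z
  -> Den e v3 R -> Den e v4 F ->
  holds e (MetricTopology v0 v1 v2 v3 v4) <-> sMetricTopology T d Z R F.
Proof. intros. unfold MetricTopology, sMetricTopology. hs. Qed.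
#[local] Hint Resolve h_MetricTopology : leaf.

Definition sMetrizable Z T :=
  exists R F a m d, sNonnegReals R F a m /\ sMetric d Z R F a m /\ sMetricTopology T d Z R F.

Lemma h_Metrizable e v0 v1 Z T : Den e v0 Z -> Den e v1 T ->
  holds e (Metrizable v0 v1) <-> sMetrizable Z T.
Proof. intros. unfold Metrizable, sMetrizable. hs. Qed.
#[local] Hint Resolve h_Metrizable : leaf.

Definition sCovers C A :=
  forall x, x ∈ A -> exists U, U ∈ C /\ x ∈ U.

Lemma h_Covers e v0 v1 C A : Den e v0 C -> Den e v1 A ->
  holds e (Covers v0 v1) <-> sCovers C A.
Proof. intros. unfold Covers, sCovers. hs. Qed.
#[local] Hint Resolve h_Covers : leaf.

Definition sCompact A Z T :=
  sub A Z /\ forall C, sub C T /\ sCovers C A ->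
  exists E, sub E C /\ sFinite E /\ sCovers E A.

Lemma h_Compact e v0 v1 v2 A Z T : Den e v0 A -> Den e v1 Z -> Den e v2 T ->
  holds e (Compact v0 v1 v2) <-> sCompact A Z T.
Proof. intros. unfold Compact, sCompact. hs. Qed.
#[local] Hint Resolve h_Compact : leaf.

Definition sCompactComplementTopology S Z T :=
  forall U, U ∈ S <-> (U = emp \/
  exists A, sCompact A Z T /\ forall x, x ∈ U <-> (x ∈ Z /\ ~ x ∈ A)).

Lemma h_CompactComplementTopology e v0 v1 v2 S Z T : Den e v0 S -> Den e v1 Z -> Den e v2 T ->
  holds e (CompactComplementTopology v0 v1 v2) <-> sCompactComplementTopology S Z T.
Proof. intros. unfold CompactComplementTopology, sCompactComplementTopology. hs. Qed.
#[local] Hint Resolve h_CompactComplementTopology : leaf.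

Definition sFirstCountable Z T :=
  forall x, x ∈ Z -> exists B, sCountable B /\
  (forall U, U ∈ B -> U ∈ T /\ x ∈ U) /\
  (forall V, V ∈ T -> x ∈ V -> exists U, U ∈ B /\ sub U V).

Lemma h_FirstCountable e v0 v1 Z T : Den e v0 Z -> Den e v1 T ->
  holds e (FirstCountable v0 v1) <-> sFirstCountable Z T.
Proof. intros. unfold FirstCountable, sFirstCountable. hs. Qed.
#[local] Hint Resolve h_FirstCountable : leaf.

End Shallow.
#[export] Hint Resolve h_Inductive_ h_Topology h_Countable h_Metrizable h_Hausdorff h_Finite
  h_CompactComplementTopology h_FirstCountable : leaf.

(** * The axioms are sentences; reduction to models *)

Definition wf (p : fml) : Prop := forall d, 0 < d -> bounded d (p d).

Lemma wf_sentence (p : var -> fml) : (forall v, wf (p v)) -> bounded 0 (sentence (fAll p)).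
Proof. intros H. apply H. lia. Qed.

Lemma wf_all (p : var -> fml) : (forall v, wf (p v)) -> wf (fAll p).
Proof. intros H d Hd. apply H. lia. Qed.

Lemma wf_ex (p : var -> fml) : (forall v, wf (p v)) -> wf (fEx p).
Proof. intros H d Hd. split; [split|]; try exact I. apply H. lia. Qed.

Lemma wf_imp p q : wf p -> wf q -> wf (fImp p q).
Proof. intros H K d Hd. split; auto. Qed.

Lemma wf_and p q : wf p -> wf q -> wf (fAnd p q).
Proof. intros H K d Hd. repeat split; auto. Qed.

Lemma wf_iff p q : wf p -> wf q -> wf (fIff p q).
Proof. intros H K d Hd. repeat split; auto. Qed.

(** The index [d - S x] is below any positive [d] whatever [x] is, so [wf] need not record which
    variables are bound. *)
Lemma wf_mem x y : wf (fMem x y).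
Proof. intros d Hd. simpl. lia. Qed.

Lemma wf_eql x y : wf (fEql x y).
Proof. intros d Hd. simpl. lia. Qed.

Lemma wf_app p n l : bounded n p -> wf (fApp p l).
Proof.
  intros B d Hd. unfold fApp.
  assert (H : forall p n f g, bounded n p -> (forall i, f i < g) -> bounded g (ren f p)).
  { clear. induction p; simpl; intros n f g B H; auto.
    - destruct B; eauto.
    - apply IHp with (S n); auto. intros [|i]; simpl; [lia|]. specialize (H i); lia. }
  apply H with n; auto. intros i. lia.
Qed.

(** [wf] speaks of positive depths only. When [n] is 0 no parameter is quantified, and the body
    itself has to supply the outermost quantifier. *)
Lemma wf_sentence_alls n : forall p : list var -> fml,
  (forall l, exists q, p l = fAll q /\ forall v, wf (q v)) ->
  bounded 0 (sentence (fAlls n p)).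
Proof.
  assert (W : forall n p, (forall l, wf (p l)) -> wf (fAlls n p)).
  { clear. induction n; simpl; intros p H; auto. apply wf_all. intros v. apply IHn. auto. }
  destruct n; cbn [fAlls]; intros p H.
  - destruct (H nil) as (q & -> & K). apply wf_sentence, K.
  - apply wf_sentence. intros v. apply W. intros l. destruct (H (v :: l)) as (q & -> & K).
    apply wf_all, K.
Qed.

Ltac solve_wf := cbv beta; lazymatch goal with
  | |- wf (fAll _) => apply wf_all; intro; solve_wf
  | |- wf (fEx _) => apply wf_ex; intro; solve_wf
  | |- wf (fImp _ _) => apply wf_imp; solve_wf
  | |- wf (fIff _ _) => apply wf_iff; solve_wf
  | |- wf (fAnd _ _) => apply wf_and; solve_wf
  | |- wf (fMem _ _) => apply wf_mem
  | |- wf (fEql _ _) => apply wf_eql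
  | |- wf (fApp _ _) => eapply wf_app; eassumption
  end.

Lemma ZF_closed q : ZF q -> bounded 0 q.
Proof.
  destruct 1.
  1-6: cbv; repeat split; lia.
  - apply wf_sentence_alls. intros l. eexists; split; [reflexivity|]. intros a. solve_wf.
  - apply wf_sentence_alls. intros l. eexists; split; [reflexivity|]. intros a. solve_wf.
Qed.

(** The main sentence is large once its abbreviations are unfolded; its boundedness is decided by
    computation. *)
Fixpoint boundedb (n : nat) (p : form) : bool :=
  match p with
  | Mem x y | Eql x y => (x <? n) && (y <? n)
  | Bot => true
  | Imp p q => boundedb n p && boundedb n q
  | All p => boundedb (S n) p
  end%bool.

Lemma boundedb_spec p : forall n, boundedb n p = true -> bounded n p.
Proof.
  induction p; simpl; intros n H; auto; try (apply andb_prop in H as [H K]); auto;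
    apply Nat.ltb_lt in H, K; auto.
Qed.

Definition main_fml : fml := (∃ Z T S,
    Topology Z T ∧ Countable Z ∧ Metrizable Z T ∧
    Hausdorff Z T ∧ ¬ Finite Z ∧
    CompactComplementTopology S Z T ∧ ¬ FirstCountable Z S)%fml.

Lemma h_main {M : Model} : holds nil main_fml <->
  exists Z T S, sTopology Z T /\ sCountable Z /\ sMetrizable Z T /\
    sHausdorff Z T /\ ~ sFinite Z /\ sCompactComplementTopology S Z T /\
    ~ sFirstCountable Z S.
Proof. unfold main_fml. hs. Qed.

Lemma provable_of_models :
  (forall M : Model, exists Z T S, sTopology Z T /\ sCountable Z /\ sMetrizable Z T /\
    sHausdorff Z T /\ ~ sFinite Z /\ sCompactComplementTopology S Z T /\
    ~ sFirstCountable Z S) -> provable ZF (sentence main_fml).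
Proof.
  intros H. assert (B : bounded 0 (sentence main_fml)).
  { apply boundedb_spec. vm_compute. reflexivity. }
  apply completeness; [exact ZF_closed|exact B|].
  intros X m rho A.
  pose (M := {| D := X; mem := m; dflt := rho 0; model_ZF := A |}).
  pose proof (proj2 (@h_main M) (H M)) as K.
  unfold holds in K. cbn [length] in K.
  refine (proj1 (sat_bounded m (sentence main_fml) 0 _ rho B _) K). intros; lia.
Qed.

Notation "⟨ x , y ⟩" := (opair x y) (at level 0, format "⟨ x ,  y ⟩") : set_scope.

(** * The natural numbers of a model *)

Section Omega.
Context {M : Model}.

Lemma infinity : exists w, sInductive w.
Proof. eapply axiom_holds; [apply ZF_inf|hs]. Qed.

(** Any inductive set can be cut down to the intersection of all of them, so the result does not
    depend on the one that [the] picks. *)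
Definition omega := sep (the sInductive) (fun x => forall v, sInductive v -> x ∈ v).

Lemma in_omega x : x ∈ omega <-> forall v, sInductive v -> x ∈ v.
Proof.
  unfold omega. rewrite in_sep by (unfold sInductive; dp).
  split; [tauto|]. intros H. split; auto. apply H, the_spec, infinity.
Qed.

Lemma omega_emp : emp ∈ omega.
Proof. apply in_omega. intros v [(e & H & ->) _]. exact H. Qed.

Lemma omega_succ x : x ∈ omega -> succ x ∈ omega.
Proof.
  rewrite !in_omega. intros H v V. destruct (proj2 V x (H v V)) as (s & Hs & ->). exact Hs.
Qed.

(** Definability replaces standardness here: Separation turns [P] into an inductive subset of
    [omega], which by minimality is all of it. *)
Lemma omega_ind (P : D -> Prop) : DP (fun r => P (r 0)) -> P emp ->
  (forall x, x ∈ omega -> P x -> P (succ x)) -> forall x, x ∈ omega -> P x.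
Proof.
  intros HP H0 HS x Hx.
  assert (K : x ∈ sep omega P); [|rewrite in_sep in K; tauto].
  apply in_omega; auto. split.
  - exists emp. rewrite in_sep; auto using omega_emp.
  - intros y Hy. rewrite in_sep in Hy by auto. exists (succ y).
    rewrite in_sep by auto. destruct Hy. auto using omega_succ.
Qed.

End Omega.

Ltac omega_induct := match goal with |- forall x, x ∈ omega -> @?P x =>
    apply (omega_ind P); [cbv beta; try solve [dp]| |] end; cbv beta.
Ltac omega_induction x := revert x; omega_induct.

Section Recursion_theorem.
Context {M : Model}.

Lemma sOmega_omega : sOmega omega.
Proof.
  split; [split|].
  - exists emp. auto using omega_emp.
  - intros x Hx. exists (succ x). auto using omega_succ.
  - intros v V x Hx. rewrite in_omega in Hx. auto.
Qed.

Lemma sOmega_unique w : sOmega w -> w = omega.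
Proof.
  intros [H K]. apply ext. intros z. split.
  - apply K, sOmega_omega. - apply sOmega_omega, H.
Qed.

Lemma mem_irrefl x : ~ x ∈ x.
Proof.
  intros H. destruct (foundation (upair x x)) as (y & Hy & K).
  - exists x. apply in_upair; auto.
  - apply in_upair in Hy. assert (y = x) as -> by tauto.
    apply K. exists x. rewrite in_upair; auto.
Qed.

Lemma mem_asym x y : x ∈ y -> ~ y ∈ x.
Proof.
  intros H H'. destruct (foundation (upair x y)) as (z & Hz & K).
  - exists x. apply in_upair; auto.
  - apply K. apply in_upair in Hz as [->| ->]; [exists y|exists x]; rewrite in_upair; auto.
Qed.

(** Otherwise [x] and [y] would be elements of each other, which Foundation excludes. *)
Lemma succ_inj x y : succ x = succ y -> x = y.
Proof.
  intros E.
  assert (H : x ∈ succ y) by (rewrite <- E, in_succ; auto).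
  assert (K : y ∈ succ x) by (rewrite E, in_succ; auto).
  apply in_succ in H as [H|H]; auto. apply in_succ in K as [K|K]; auto.
  apply mem_asym in H; tauto.
Qed.

Lemma succ_emp x : succ x <> emp.
Proof. intros E. apply (in_emp x). rewrite <- E, in_succ. auto. Qed.

Lemma omega_cases x : x ∈ omega -> x = emp \/ exists y, y ∈ omega /\ x = succ y.
Proof.
  omega_induction x; [auto|eauto].
Qed.

Lemma omega_trans x : x ∈ omega -> forall y, y ∈ x -> y ∈ omega.
Proof.
  omega_induction x; [ |].
  - intros y H. apply in_emp in H; tauto.
  - intros x Hx IH y H. apply in_succ in H as [H| ->]; auto.
Qed.

Lemma omega_mem_trans x : x ∈ omega -> forall y z, y ∈ x -> z ∈ y -> z ∈ x.
Proof.
  omega_induction x; [ |].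
  - intros y z H. apply in_emp in H; tauto.
  - intros x Hx IH y z H K. apply in_succ in H as [H| ->]; apply in_succ; eauto.
Qed.

Lemma emp_in_succ x : x ∈ omega -> emp ∈ succ x.
Proof.
  omega_induction x; [ |].
  - apply in_succ; auto.
  - intros x _ H. apply in_succ; auto.
Qed.

Lemma succ_mem_succ y : y ∈ omega -> forall x, x ∈ y -> succ x ∈ succ y.
Proof.
  omega_induction y; [ |].
  - intros x H. apply in_emp in H; tauto.
  - intros y _ H x K. apply in_succ in K as [K| ->]; apply in_succ; auto.
Qed.

Lemma omega_trichotomy x : x ∈ omega -> forall y, y ∈ omega -> x ∈ y \/ x = y \/ y ∈ x.
Proof.
  omega_induction x; [ |].
  - intros y Hy. apply omega_cases in Hy as [->|(z & Hz & ->)]; auto using emp_in_succ.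
  - intros x Hx IH y Hy. destruct (IH y Hy) as [H|[->|H]].
    + apply succ_mem_succ in H; auto. apply in_succ in H as [H|H]; auto.
    + right; right. apply in_succ; auto.
    + right; right. apply in_succ; auto.
Qed.

(** * Recursion *)

(** The union of the set of values, which is the value itself when there is exactly one. The double
    union of [g] contains the second components of its pairs. *)
Definition app2 g x y := bigcup (sep (bigcup (bigcup g)) (fun z => ⟨⟨x, y⟩, z⟩ ∈ g)).

Lemma DT_app2' u t s : DT u -> DT t -> DT s -> DT (fun r => app2 (u r) (t r) (s r)).
Proof. intros. unfold app2. dp. Qed.

Lemma app2_eq g x y z : ⟨⟨x, y⟩, z⟩ ∈ g ->
  (forall z', ⟨⟨x, y⟩, z'⟩ ∈ g -> z' = z) -> app2 g x y = z.
Proof.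
  intros H U. unfold app2. apply ext. intros t. rewrite in_bigcup. split.
  - intros (z' & K & Ht). rewrite in_sep in K by dp.
    destruct K as [_ K]. apply U in K. now subst.
  - intros Ht. exists z. split; auto. rewrite in_sep by dp. split; auto.
    apply in_bigcup. exists (upair ⟨x, y⟩ z). rewrite in_upair. split; auto.
    apply in_bigcup. exists ⟨⟨x, y⟩, z⟩. split; auto. apply in_upair; auto.
Qed.

Section Recursion.
Variables (b : D -> D) (h : D -> D -> D).
Hypothesis b_DT : DT (fun r => b (r 0)).
Hypothesis h_DT : DT (fun r => h (r 0) (r 1)).
Hypothesis b_omega : forall x, x ∈ omega -> b x ∈ omega.
Hypothesis h_omega : forall x z, x ∈ omega -> z ∈ omega -> h x z ∈ omega.

Definition rec_closed C :=
  (forall x, x ∈ omega -> ⟨⟨x, emp⟩, b x⟩ ∈ C) /\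
  (forall x y z, x ∈ omega -> y ∈ omega -> z ∈ omega ->
     ⟨⟨x, y⟩, z⟩ ∈ C -> ⟨⟨x, succ y⟩, h x z⟩ ∈ C).

(** The graph is the least set closed under the recursion clauses, which avoids gluing finite
    approximations. The recursion runs on the second argument, with [x] as a parameter. *)
Definition rec := sep (prod (prod omega omega) omega) (fun t => forall C, rec_closed C -> t
  ∈ C).

Lemma in_rec t : t ∈ rec <-> t ∈ prod (prod omega omega) omega /\ forall C, rec_closed C ->
  t ∈ C.
Proof. unfold rec. apply in_sep. unfold rec_closed. dp. Qed.

Lemma rec_rec_closed : rec_closed rec.
Proof.
  split.
  - intros x Hx. apply in_rec. split.
    + rewrite !opair_in_prod. auto using omega_emp.
    + intros C [H _]; auto.
  - intros x y z Hx Hy Hz H. apply in_rec in H as [_ H]. apply in_rec. split.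
    + rewrite !opair_in_prod. auto using omega_succ.
    + intros C HC. apply HC; auto.
Qed.

(** By leastness: the triples of [rec] that arise from one of the two clauses already form a closed
    set. *)
Lemma rec_inv x y z : ⟨⟨x, y⟩, z⟩ ∈ rec -> (y = emp /\ z = b x) \/
  exists y' z', y' ∈ omega /\ y = succ y' /\ z = h x z' /\ ⟨⟨x, y'⟩, z'⟩ ∈ rec.
Proof.
  intros H. set (Q := fun t => forall x y z, t = ⟨⟨x, y⟩, z⟩ -> (y = emp /\ z = b x) \/
    exists y' z', y' ∈ omega /\ y = succ y' /\ z = h x z' /\ ⟨⟨x, y'⟩, z'⟩ ∈ rec).
  assert (HQ : DP (fun r => Q (r 0))) by (unfold Q; dp).
  assert (K : rec_closed (sep rec Q)).
  { destruct rec_rec_closed as [A B]. split.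
    - intros x1 Hx. rewrite in_sep by auto. split; auto. intros x2 y2 z2 E.
      apply opair_inj in E as [E <-]. apply opair_inj in E as [<- <-]. auto.
    - intros x1 y1 z1 Hx Hy Hz K. rewrite in_sep in * by auto. destruct K as [K _].
      split; auto. intros x2 y2 z2 E.
      apply opair_inj in E as [E <-]. apply opair_inj in E as [<- <-]. right.
      exists y1, z1. auto. }
  apply in_rec in H as [_ H]. apply H in K. rewrite in_sep in K by auto.
  destruct K as [_ K]. apply K; auto.
Qed.

Lemma rec_total y : y ∈ omega -> forall x, x ∈ omega -> exists z, z ∈ omega /\ ⟨⟨x, y⟩, z⟩ ∈
  rec.
Proof.
  destruct rec_rec_closed as [A B].
  omega_induction y; [eauto|].
  intros y Hy IH x Hx. destruct (IH x Hx) as (z & Hz & K). exists (h x z). auto.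
Qed.

Lemma rec_functional y : y ∈ omega -> forall x z z',
  ⟨⟨x, y⟩, z⟩ ∈ rec -> ⟨⟨x, y⟩, z'⟩ ∈ rec -> z = z'.
Proof.
  omega_induction y; [ |].
  - intros x z z' H K. apply rec_inv in H as [[_ ->]|(? & ? & _ & E & _)];
      [|symmetry in E; apply succ_emp in E; tauto].
    apply rec_inv in K as [[_ ->]|(? & ? & _ & E & _)];
      [|symmetry in E; apply succ_emp in E; tauto]. auto.
  - intros y Hy IH x z z' H K.
    apply rec_inv in H as [[E _]|(y1 & z1 & _ & E & -> & H)]; [apply succ_emp in E; tauto|].
    apply rec_inv in K as [[E' _]|(y2 & z2 & _ & E' & -> & K)]; [apply succ_emp in E'; tauto|].
    apply succ_inj in E, E'. subst. f_equal. eauto.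
Qed.

Lemma rec_dom x y z : ⟨⟨x, y⟩, z⟩ ∈ rec -> x ∈ omega /\ y ∈ omega /\ z ∈ omega.
Proof. rewrite in_rec, !opair_in_prod. tauto. Qed.

Lemma rec_app2 x y z : x ∈ omega -> y ∈ omega ->
  ⟨⟨x, y⟩, z⟩ ∈ rec <-> z = app2 rec x y.
Proof.
  intros Hx Hy. destruct (rec_total y Hy x Hx) as (z0 & _ & H).
  rewrite (app2_eq rec x y z0); eauto using rec_functional.
  split; [eauto using rec_functional|]. intros ->; auto.
Qed.

Lemma rec_app2_omega x y : x ∈ omega -> y ∈ omega -> app2 rec x y ∈ omega.
Proof. intros Hx Hy. apply (rec_dom x y). apply rec_app2; auto. Qed.

Lemma rec_app2_emp x : x ∈ omega -> app2 rec x emp = b x.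
Proof. intros Hx. symmetry. apply rec_app2; auto using omega_emp. apply rec_rec_closed, Hx. Qed.

Lemma rec_app2_succ x y : x ∈ omega -> y ∈ omega ->
  app2 rec x (succ y) = h x (app2 rec x y).
Proof.
  intros Hx Hy. symmetry. apply rec_app2; auto using omega_succ.
  apply rec_rec_closed; auto using rec_app2_omega. apply rec_app2; auto.
Qed.

Lemma rec_Fun2 : sFun2 rec omega omega.
Proof.
  eexists; split; [reflexivity|]. repeat split.
  - intros p H. apply in_rec in H as [H _]. apply mem_prod in H as (x & Hx & y & Hy & ->).
    eauto 6.
  - intros p H. apply mem_prod in H as (x & Hx & y & Hy & ->).
    destruct (rec_total y Hy x Hx) as (z & _ & H). eauto.
  - intros p z z' [H K]. assert (L := H). apply in_rec in L as [L _].
    apply opair_in_prod in L as [L _]. apply mem_prod in L as (x & Hx & y & Hy & ->).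
    eapply rec_functional; eauto.
Qed.
End Recursion.
End Recursion_theorem.

(** * Arithmetic *)

Definition addg {M : Model} := rec (fun x => x) (fun _ z => succ z).
Definition add {M : Model} := app2 addg.
Definition mulg {M : Model} := rec (fun _ => emp) (fun x z => add z x).
Definition mul {M : Model} := app2 mulg.

Lemma DT_add {M : Model} t s : DT t -> DT s -> DT (fun r => add (t r) (s r)).
Proof. intros. unfold add. apply DT_app2'; dp. Qed.
Lemma DT_mul {M : Model} t s : DT t -> DT s -> DT (fun r => mul (t r) (s r)).
Proof. intros. unfold mul. apply DT_app2'; dp. Qed.

#[export] Hint Extern 0 (DT (fun r => add _ _)) => apply DT_add; dp : dp.
#[export] Hint Extern 0 (DT (fun r => mul _ _)) => apply DT_mul; dp : dp.
#[export] Hint Extern 0 (DT (fun r => app2 _ _ _)) => apply DT_app2'; dp : dp.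

Section Arith.
Context {M : Model}.

Lemma addg_app2 x y z : x ∈ omega -> y ∈ omega -> ⟨⟨x, y⟩, z⟩ ∈ addg <-> z = add x y.
Proof. apply rec_app2; auto using omega_succ; dp. Qed.
Lemma add_omega x y : x ∈ omega -> y ∈ omega -> add x y ∈ omega.
Proof. apply rec_app2_omega; auto using omega_succ; dp. Qed.
Lemma add_emp x : x ∈ omega -> add x emp = x.
Proof. apply (rec_app2_emp (fun x => x) (fun _ z => succ z)); auto using omega_succ; dp. Qed.
Lemma add_succ x y : x ∈ omega -> y ∈ omega -> add x (succ y) = succ (add x y).
Proof. apply (rec_app2_succ (fun x => x) (fun _ z => succ z)); auto using omega_succ; dp. Qed.

Lemma mulg_app2 x y z : x ∈ omega -> y ∈ omega -> ⟨⟨x, y⟩, z⟩ ∈ mulg <-> z = mul x y.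
Proof. apply rec_app2; auto using omega_emp, add_omega; dp. Qed.
Lemma mul_omega x y : x ∈ omega -> y ∈ omega -> mul x y ∈ omega.
Proof. apply rec_app2_omega; auto using omega_emp, add_omega; dp. Qed.
Lemma mul_emp x : x ∈ omega -> mul x emp = emp.
Proof.
  apply (rec_app2_emp (fun _ => emp) (fun x z => add z x)); auto using omega_emp, add_omega; dp.
Qed.
Lemma mul_succ x y : x ∈ omega -> y ∈ omega -> mul x (succ y) = add (mul x y) x.
Proof.
  apply (rec_app2_succ (fun _ => emp) (fun x z => add z x)); auto using omega_emp,
    add_omega; dp.
Qed.

Lemma addg_dom x y z : ⟨⟨x, y⟩, z⟩ ∈ addg -> x ∈ omega /\ y ∈ omega /\ z ∈ omega.
Proof. apply rec_dom; dp. Qed.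
Lemma mulg_dom x y z : ⟨⟨x, y⟩, z⟩ ∈ mulg -> x ∈ omega /\ y ∈ omega /\ z ∈ omega.
Proof. apply rec_dom; dp. Qed.

Lemma sAddition_addg : sAddition addg omega.
Proof.
  split; [apply rec_Fun2; auto using omega_succ; dp|]. split.
  - intros x Hx e ->. apply addg_app2; auto using omega_emp. now rewrite add_emp.
  - intros x y z s t (H & -> & ->).
    destruct (addg_dom _ _ _ H) as (Hx & Hy & Hz).
    apply addg_app2 in H; auto. apply addg_app2; auto using omega_succ.
    rewrite add_succ; congruence.
Qed.

Lemma sMultiplication_mulg : sMultiplication mulg addg omega.
Proof.
  split; [apply rec_Fun2; auto using omega_emp, add_omega; dp|]. split.
  - intros x Hx e ->. apply mulg_app2; auto using omega_emp. now rewrite mul_emp.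
  - intros x y z s t (H & -> & K).
    destruct (mulg_dom _ _ _ H) as (Hx & Hy & Hz).
    apply mulg_app2 in H; auto. apply mulg_app2; auto using omega_succ.
    rewrite mul_succ, <- H by auto. apply addg_app2; auto.
Qed.
End Arith.

#[export] Hint Resolve omega_emp omega_succ add_omega mul_omega : om.
Ltac om := solve [eauto with om].

(** * The semiring and the order of the natural numbers *)

Section Semiring.
Context {M : Model}.

Lemma emp_add x : x ∈ omega -> add emp x = x.
Proof.
  omega_induction x; [apply add_emp; om|]. intros x Hx IH. rewrite add_succ by om. congruence.
Qed.

Lemma succ_add x y : x ∈ omega -> y ∈ omega -> add (succ x) y = succ (add x y).
Proof.
  intros Hx. omega_induction y; [rewrite !add_emp by om; auto|].
  intros y Hy IH. rewrite !add_succ by om. congruence.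
Qed.

Lemma add_comm x y : x ∈ omega -> y ∈ omega -> add x y = add y x.
Proof.
  intros Hx. omega_induction y; [rewrite add_emp, emp_add by om; auto|].
  intros y Hy IH. rewrite add_succ, succ_add by om. congruence.
Qed.

Lemma add_assoc x y z : x ∈ omega -> y ∈ omega -> z ∈ omega ->
  add x (add y z) = add (add x y) z.
Proof.
  intros Hx Hy. omega_induction z; [rewrite !add_emp by om; auto|].
  intros z Hz IH. rewrite !add_succ by om. congruence.
Qed.

Lemma emp_mul x : x ∈ omega -> mul emp x = emp.
Proof.
  omega_induction x; [apply mul_emp; om|]. intros x Hx IH.
  rewrite mul_succ, add_emp by om. auto.
Qed.

Lemma succ_mul x y : x ∈ omega -> y ∈ omega -> mul (succ x) y = add (mul x y) y.
Proof.
  intros Hx. omega_induction y; [rewrite !mul_emp, add_emp by om; auto|].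
  intros y Hy IH. rewrite !mul_succ, IH, !add_succ, <- !add_assoc by om.
  f_equal. f_equal. apply add_comm; om.
Qed.

Lemma mul_comm x y : x ∈ omega -> y ∈ omega -> mul x y = mul y x.
Proof.
  intros Hx. omega_induction y; [rewrite mul_emp, emp_mul by om; auto|].
  intros y Hy IH. rewrite mul_succ, succ_mul by om. congruence.
Qed.

Lemma mul_add x y z : x ∈ omega -> y ∈ omega -> z ∈ omega ->
  mul (add x y) z = add (mul x z) (mul y z).
Proof.
  intros Hx Hy. omega_induction z; [rewrite !mul_emp, add_emp by om; auto|].
  intros z Hz IH. rewrite !mul_succ, IH by om.
  rewrite <- !add_assoc by om. f_equal. rewrite !add_assoc by om. f_equal.
  apply add_comm; om.
Qed.

Lemma mul_assoc x y z : x ∈ omega -> y ∈ omega -> z ∈ omega ->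
  mul x (mul y z) = mul (mul x y) z.
Proof.
  intros Hx Hy. omega_induction z; [rewrite !mul_emp by om; auto|].
  intros z Hz IH. rewrite !mul_succ by om.
  rewrite (mul_comm x), mul_add by om. rewrite (mul_comm _ x), (mul_comm y x) by om.
  congruence.
Qed.

Lemma lt_add_succ y : y ∈ omega -> forall x, x ∈ omega ->
  (x ∈ y <-> exists d, d ∈ omega /\ y = add x (succ d)).
Proof.
  omega_induction y.
  - intros x Hx. split; [intros H; apply in_emp in H; tauto|].
    intros (d & Hd & E). rewrite add_succ in E by om. symmetry in E.
    apply succ_emp in E; tauto.
  - intros y Hy IH x Hx. rewrite in_succ, IH by auto. split.
    + intros [(d & Hd & E)| ->].
      * exists (succ d). rewrite add_succ by om. rewrite E. split; om.
      * exists emp. rewrite add_succ, add_emp by om. split; om.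
    + intros (d & Hd & E). rewrite add_succ in E by om. apply succ_inj in E.
      apply omega_cases in Hd as [->|(d' & Hd & ->)].
      * right. now rewrite add_emp in E by om.
      * left; eauto.
Qed.

(** The natural numbers of the model as a Rocq type, so that [ring] can work on them. *)
Definition N := {x : D | x ∈ omega}.
Definition val (x : N) : D := proj1_sig x.
Definition mkN x (H : x ∈ omega) : N := exist _ x H.
Lemma val_omega x : val x ∈ omega.
Proof. exact (proj2_sig x). Qed.
Lemma val_inj x y : val x = val y -> x = y.
Proof. intros H. apply eq_sig_hprop; auto. intros; apply proof_irrelevance. Qed.

Definition N0 := mkN emp omega_emp.
Definition NS (x : N) := mkN (succ (val x)) (omega_succ _ (val_omega x)).
Definition Nadd (x y : N) := mkN (add (val x) (val y)) (add_omega _ _ (val_omega x)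
  (val_omega y)).
Definition Nmul (x y : N) := mkN (mul (val x) (val y)) (mul_omega _ _ (val_omega x)
  (val_omega y)).
Definition Nlt (x y : N) := val x ∈ val y.
End Semiring.

Declare Scope omega_scope.
Delimit Scope omega_scope with omega.
Bind Scope omega_scope with N.
Notation "0" := N0 : omega_scope.
Notation "1" := (NS N0) : omega_scope.
Notation "x + y" := (Nadd x y) : omega_scope.
Notation "x * y" := (Nmul x y) : omega_scope.
Notation "x < y" := (Nlt x y) : omega_scope.
Local Open Scope omega_scope.
#[export] Hint Resolve val_omega : om.

Section Order.
Context {M : Model}.
Implicit Types x y z : N.

Lemma N_semiring : semi_ring_theory 0 1 Nadd Nmul eq.
Proof.
  split; intros; apply val_inj; cbn [val proj1_sig Nadd Nmul N0 NS mkN].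
  - apply emp_add; om.
  - apply add_comm; om.
  - apply add_assoc; om.
  - rewrite succ_mul, emp_mul, emp_add; om.
  - apply emp_mul; om.
  - apply mul_comm; om.
  - apply mul_assoc; om.
  - apply mul_add; om.
Qed.
Add Ring N_ring : N_semiring.

Lemma NS_eq x : NS x = x + 1.
Proof. apply val_inj. simpl. rewrite add_succ, add_emp; om. Qed.

(** Turns an inequality into an equation: later proofs name the difference and leave an identity to
    [ring]. *)
Lemma lt_iff x y : x < y <-> exists d, y = x + d + 1.
Proof.
  unfold Nlt. rewrite lt_add_succ by om. split.
  - intros (d & Hd & E). exists (mkN d Hd). apply val_inj. rewrite <- NS_eq. simpl.
    rewrite E, add_succ by om. auto.
  - intros [d ->]. exists (val d). split; [om|]. rewrite <- NS_eq. simpl.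
    rewrite add_succ; om.
Qed.

Lemma lt_irrefl x : ~ x < x.
Proof. apply mem_irrefl. Qed.

Lemma lt_trans x y z : x < y -> y < z -> x < z.
Proof. intros H K. eapply omega_mem_trans; eauto with om. Qed.

Lemma lt_total x y : x < y \/ x = y \/ y < x.
Proof.
  destruct (omega_trichotomy (val x) (val_omega x) (val y) (val_omega y)) as [H|[H|H]];
    auto using val_inj.
Qed.

Lemma not_lt x y : ~ x < y <-> exists d, x = y + d.
Proof.
  split.
  - intros H. destruct (lt_total x y) as [K|[->|K]]; [tauto| |].
    + exists 0. ring.
    + apply lt_iff in K as [d ->]. exists (d + 1). ring.
  - intros [d ->] H. apply lt_iff in H as [e E]. apply (lt_irrefl y).
    apply lt_iff. exists (d + e). rewrite E at 1. ring.
Qed.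

Lemma lt_S x y : x < y + 1 <-> x < y \/ x = y.
Proof.
  rewrite <- NS_eq. unfold Nlt. simpl. rewrite in_succ.
  split; intros [H|H]; auto using val_inj. right; now f_equal.
Qed.

Lemma pos_iff x : val x <> emp <-> exists d, x = d + 1.
Proof.
  split.
  - intros H. destruct (omega_cases (val x) (val_omega x)) as [E|(d & Hd & E)]; [tauto|].
    exists (mkN d Hd). apply val_inj. rewrite <- NS_eq. exact E.
  - intros [d ->]. rewrite <- NS_eq. apply succ_emp.
Qed.

Lemma lt_add_r x y z : x < y -> x + z < y + z.
Proof. rewrite !lt_iff. intros [d ->]. exists d. ring. Qed.

Lemma lt_mul_r x y z : x < y -> val z <> emp -> x * z < y * z.
Proof.
  rewrite pos_iff, !lt_iff. intros [d ->] [e ->]. exists (d * e + d + e). ring.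
Qed.

Lemma add_cancel_r x y z : x + z = y + z -> x = y.
Proof.
  intros E. destruct (lt_total x y) as [H|[H|H]]; auto;
    apply (lt_add_r _ _ z) in H; rewrite E in H; apply lt_irrefl in H; tauto.
Qed.

Lemma lt_mul_cancel x y z : x * z < y * z -> x < y.
Proof.
  intros H. destruct (classic (val z = emp)) as [E|E].
  { assert (z = 0) as -> by (apply val_inj; auto).
    replace (x * 0) with 0 in H by ring. replace (y * 0) with 0 in H by ring.
    apply lt_irrefl in H; tauto. }
  destruct (lt_total x y) as [K|[->|K]]; auto.
  - apply lt_irrefl in H; tauto.
  - apply (lt_mul_r _ _ z) in K; auto. destruct (lt_irrefl (x * z)). eapply lt_trans; eauto.
Qed.
End Order.

(** * Fractions and cuts *)

Section Fractions.
Context {M : Model}.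
Implicit Types i j k l : N.
Add Ring N_ring : N_semiring.

Definition pos i := val i <> emp.
Definition fr i j := ⟨val i, val j⟩.
(** This one set plays three parts: the positive fractions, the real number 0, and the points of the
    space. *)
Definition Fr := sep (prod omega omega)
  (fun p => exists i j : D, ~ i = emp /\ ~ j = emp /\ p = ⟨i, j⟩).

Lemma pos_1 : pos 1.
Proof. apply pos_iff. exists 0. ring. Qed.

Lemma pos_add i j : pos i -> pos (i + j).
Proof. unfold pos. rewrite !pos_iff. intros [d ->]. exists (d + j). ring. Qed.

Lemma fr_inj i j k l : fr i j = fr k l -> i = k /\ j = l.
Proof. intros E. apply opair_inj in E as [E F]. auto using val_inj. Qed.

Lemma mem_Fr p : p ∈ Fr <-> exists i j, pos i /\ pos j /\ p = fr i j.
Proof.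
  unfold Fr. rewrite in_sep by dp. split.
  - intros [H (i & j & Hi & Hj & ->)]. apply opair_in_prod in H as [Ki Kj].
    exists (mkN i Ki), (mkN j Kj). auto.
  - intros (i & j & Hi & Hj & ->). unfold fr. rewrite opair_in_prod.
    split; [auto with om|]. exists (val i), (val j). auto.
Qed.

Lemma fr_Fr i j : fr i j ∈ Fr <-> pos i /\ pos j.
Proof.
  rewrite mem_Fr. split; [|intros []; eauto].
  intros (i' & j' & H & K & E). apply fr_inj in E as [-> ->]. auto.
Qed.

Lemma sFractions_Fr : sFractions Fr omega.
Proof.
  intros p. rewrite mem_Fr. split.
  - intros (i & j & Hi & Hj & ->). exists (val i). split; [om|]. exists (val j).
    split; [om|]. auto.
  - intros (i & Hi & j & Hj & Ki & Kj & ->). exists (mkN i Hi), (mkN j Hj). auto.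
Qed.

Lemma mulg_val i j u : ⟨⟨val i, val j⟩, u⟩ ∈ mulg <-> u = val (i * j).
Proof. apply mulg_app2; om. Qed.

Lemma addg_val i j u : ⟨⟨val i, val j⟩, u⟩ ∈ addg <-> u = val (i + j).
Proof. apply addg_app2; om. Qed.

Lemma FracLt_fr i j k l : sFracLt mulg (fr i j) (fr k l) <-> i * l < k * j.
Proof.
  split.
  - intros (i' & j' & k' & l' & u & v & E & F & H & K & L).
    apply opair_inj in E as [<- <-]. apply opair_inj in F as [<- <-].
    apply mulg_val in H as ->. apply mulg_val in K as ->. exact L.
  - intros H. exists (val i), (val j), (val k), (val l), (val (i * l)), (val (k * j)).
    rewrite !mulg_val. auto.
Qed.

Lemma FracAdd_fr i j k l r : sFracAdd addg mulg r (fr i j) (fr k l) <->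
  r = fr (i * l + k * j) (j * l).
Proof.
  split.
  - intros (i' & j' & k' & l' & u & v & s & t & E & F & H & K & L & O & ->).
    apply opair_inj in E as [<- <-]. apply opair_inj in F as [<- <-].
    apply mulg_val in H as ->. apply mulg_val in K as ->. apply addg_val in L as ->.
    apply mulg_val in O as ->. reflexivity.
  - intros ->. exists (val i), (val j), (val k), (val l), (val (i * l)), (val (k * j)),
      (val (i * l + k * j)), (val (j * l)).
    rewrite !mulg_val, !addg_val. auto 10.
Qed.

(* The real number 1/i: the fractions k/l with l < k i. *)
Definition inv (i : D) := sep Fr (fun p => exists k l : D, p = ⟨k, l⟩ /\ l ∈ mul k i).

Lemma fr_inv i k l : fr k l ∈ inv (val i) <-> pos k /\ pos l /\ l < k * i.
Proof.
  unfold inv. rewrite in_sep, fr_Fr by dp. split.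
  - intros [[] (k' & l' & E & L)]. apply opair_inj in E as [<- <-]. auto.
  - intros (? & ? & L). split; auto. exists (val k), (val l). auto.
Qed.

Lemma inv_Fr (i : D) : sub (inv i) Fr.
Proof. intros p. unfold inv. rewrite in_sep by dp. tauto. Qed.

Lemma mem_inv i p : p ∈ inv (val i) <->
  exists k l, pos k /\ pos l /\ p = fr k l /\ l < k * i.
Proof.
  split.
  - intros H. assert (K := H). apply inv_Fr, mem_Fr in K as (k & l & _ & _ & ->).
    apply fr_inv in H as (? & ? & ?). eauto 6.
  - intros (k & l & ? & ? & -> & ?). apply fr_inv; auto.
Qed.

Lemma inv_antitone i j : ~ j < i -> sub (inv (val i)) (inv (val j)).
Proof.
  intros H p K. apply not_lt in H as [d ->].
  apply mem_inv in K as (k & l & ? & ? & -> & L).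
  apply fr_inv. repeat split; auto.
  apply lt_iff in L as [e L]. apply lt_iff. exists (e + k * d).
  transitivity (k * i + k * d); [ring|]. rewrite L. ring.
Qed.

(** The fraction 1/i is the test element that tells these cuts apart: it belongs to the cuts of
    smaller numbers but not to its own. *)
Lemma fr_1_inv i j : pos i -> (fr 1 i ∈ inv (val j) <-> i < j).
Proof.
  intros Hi. rewrite fr_inv. replace (1 * j) with j by ring.
  pose proof pos_1. tauto.
Qed.

Lemma inv_lt i j : pos i -> i < j -> ~ sub (inv (val j)) (inv (val i)).
Proof.
  intros Hi H K. apply (lt_irrefl i), fr_1_inv, K, fr_1_inv; auto.
Qed.

Lemma sCut_Fr : sCut Fr Fr mulg.
Proof.
  repeat split.
  - intros p; auto.
  - exists (fr 1 1). apply fr_Fr. auto using pos_1.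
  - auto.
  - intros p H. apply mem_Fr in H as (k & l & Hk & Hl & ->).
    exists (fr k (l + 1)). rewrite fr_Fr, FracLt_fr. repeat split; auto using pos_add.
    apply pos_iff in Hk as [k' ->]. apply lt_iff. exists k'. ring.
Qed.

Lemma sCut_inv i : pos i -> sCut (inv (val i)) Fr mulg.
Proof.
  intros Hi. split; [apply inv_Fr|]. split; [|split].
  - exists (fr (1 + 1) 1). apply fr_inv. repeat split; auto using pos_add, pos_1.
    apply pos_iff in Hi as [d ->]. apply lt_iff. exists (d + d). ring.
  - intros p H q K L. apply mem_inv in H as (k & l & Hk & Hl & -> & H).
    apply mem_Fr in K as (k' & l' & Hk' & Hl' & ->). apply FracLt_fr in L.
    (* Both sides of l' < k' i are multiplied by k, and k' l lies strictly between the products. *)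
    apply fr_inv. repeat split; auto. apply lt_mul_cancel with k.
    apply lt_trans with (k' * l).
    + replace (l' * k) with (k * l') by ring. exact L.
    + apply (lt_mul_r _ _ k') in H; auto. replace (k' * l) with (l * k') by ring.
      replace (k' * i * k) with (k * i * k') by ring. exact H.
  - (* the mediant of 1/i and k/l *)
    intros p H. apply mem_inv in H as (k & l & Hk & Hl & -> & H).
    apply lt_iff in H as [d H].
    exists (fr (k + 1) (l + i)). rewrite fr_inv, FracLt_fr. repeat split; auto using pos_add.
    + apply lt_iff. exists d. transitivity (k * i + i); [ring|]. rewrite H. ring.
    + apply lt_iff. exists d. transitivity (k * i + k * l); [ring|]. rewrite H. ring.
Qed.

Definition reals := sep (power Fr) (fun U => sCut U Fr mulg).

Lemma mem_reals U : U ∈ reals <-> sCut U Fr mulg.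
Proof.
  unfold reals. rewrite in_sep by (unfold sCut, sFracLt; dp). rewrite in_power.
  split; [tauto|]. intros H; split; auto. apply H.
Qed.

Lemma sNonnegReals_reals : sNonnegReals reals Fr addg mulg.
Proof.
  exists omega. exact (conj sOmega_omega (conj sAddition_addg
    (conj sMultiplication_mulg (conj sFractions_Fr mem_reals)))).
Qed.

(** Since k/l is positive, i/j is strictly below any a/b that bounds i/j + k/l. Upward closure of
    cuts asks for this strictness. *)
Lemma fr_le_sum i j k l a b : pos k -> pos j -> pos b ->
  ~ a * (j * l) < (i * l + k * j) * b -> i * b < a * j.
Proof.
  intros Hk Hj Hb H. apply not_lt in H as [e E]. apply lt_mul_cancel with l.
  apply pos_iff in Hk as [k' ->], Hb as [b' ->]. apply pos_iff in Hj as [j' ->].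
  apply lt_iff.
  (* This is e + k j b - 1, expanded to avoid subtraction. *)
  exists (e + k' * j' * b' + k' * j' + k' * b' + j' * b' + k' + j' + b').
  transitivity (a * ((j' + 1) * l)); [ring|]. rewrite E. ring.
Qed.

(** * The metric *)

(* The point that has no compact neighbourhood. *)
Definition center := fr 1 1.

(* p > wt(z), where wt(center) = 0 and wt(i/j) = 1/i otherwise. *)
Definition above_wt z p := z = center \/ exists i j : D, z = ⟨i, j⟩ /\ p ∈ inv i.
(** For upper cuts the maximum is the intersection; when the points agree the condition is void and
    leaves [Fr], the number 0. *)
Definition dist z w := sep Fr (fun p => z = w \/ above_wt z p /\ above_wt w p).

Lemma mem_dist z w p : p ∈ dist z w <-> p ∈ Fr /\ (z = w \/ above_wt z p /\ above_wt w p).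
Proof. unfold dist. rewrite in_sep by (unfold above_wt, inv; dp). tauto. Qed.

Lemma above_wt_fr i j p : fr i j <> center -> (above_wt (fr i j) p <-> p ∈ inv (val i)).
Proof.
  intros H. split.
  - intros [E|(i' & j' & E & K)]; [tauto|]. apply opair_inj in E as [<- <-]. auto.
  - intros K. right. exists (val i), (val j). auto.
Qed.

Lemma dist_refl z : dist z z = Fr.
Proof. apply ext. intros p. rewrite mem_dist. tauto. Qed.

Lemma dist_sym z w : dist z w = dist w z.
Proof. apply ext. intros p. rewrite !mem_dist. intuition. Qed.

Lemma dist_center i j : fr i j <> center -> dist center (fr i j) = inv (val i).
Proof.
  intros H. apply ext. intros p. rewrite mem_dist, above_wt_fr by auto.
  pose proof (inv_Fr (val i) p). unfold above_wt. intuition congruence.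
Qed.

Lemma dist_sub_inv i j w : fr i j <> center -> fr i j <> w ->
  sub (dist (fr i j) w) (inv (val i)).
Proof. intros H K p. rewrite mem_dist, above_wt_fr by auto. tauto. Qed.

(** The larger of two weights is one of them, and it is not the weight 0 of the center. Questions
    about nonzero distances thus reduce to the cuts [inv]. *)
Lemma dist_cases z w : z ∈ Fr -> w ∈ Fr -> z <> w ->
  exists i, pos i /\ dist z w = inv (val i).
Proof.
  intros Hz Hw N. apply mem_Fr in Hz as (i & j & Hi & Hj & ->), Hw as (k & l & Hk & Hl & ->).
  destruct (classic (fr i j = center)) as [E|E].
  { rewrite E in *. exists k. rewrite dist_center; auto. }
  destruct (classic (fr k l = center)) as [E'|E'].
  { rewrite E' in *. exists i. rewrite dist_sym, dist_center; auto. }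
  assert (K : forall p, p ∈ dist (fr i j) (fr k l) <-> p ∈ inv (val i) /\ p ∈ inv (val k)).
  { intros p. rewrite mem_dist, !above_wt_fr by auto.
    pose proof (inv_Fr (val i) p). intuition. }
  destruct (classic (k < i)) as [L|L].
  - exists k. split; auto. apply ext. intros p. rewrite K.
    assert (~ i < k) as L' by (intros L'; apply (lt_irrefl i); eapply lt_trans; eauto).
    pose proof (inv_antitone k i L' p). tauto.
  - exists i. split; auto. apply ext. intros p. rewrite K.
    pose proof (inv_antitone i k L p). tauto.
Qed.

Lemma dist_neq z w : z ∈ Fr -> w ∈ Fr -> dist z w = Fr -> z = w.
Proof.
  intros Hz Hw E. apply NNPP. intros N.
  destruct (dist_cases z w) as (i & Hi & E'); auto.
  apply (lt_irrefl i), (fr_1_inv i i Hi). rewrite <- E', E. apply fr_Fr.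
  auto using pos_1.
Qed.

Lemma sCut_dist z w : z ∈ Fr -> w ∈ Fr -> sCut (dist z w) Fr mulg.
Proof.
  intros Hz Hw. destruct (classic (z = w)) as [->|N].
  - rewrite dist_refl. apply sCut_Fr.
  - destruct (dist_cases z w) as (i & Hi & ->); auto using sCut_inv.
Qed.

Definition dmet := sep (prod (prod Fr Fr) reals)
  (fun t => exists z w, t = ⟨⟨z, w⟩, dist z w⟩).

Lemma mem_dmet z w r : ⟨⟨z, w⟩, r⟩ ∈ dmet <-> z ∈ Fr /\ w ∈ Fr /\ r = dist z w.
Proof.
  unfold dmet. rewrite in_sep by (unfold dist, above_wt, inv; dp).
  rewrite !opair_in_prod, mem_reals. split.
  - intros [[[Hz Hw] Hr] (z' & w' & E)]. apply opair_inj in E as [E ->].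
    apply opair_inj in E as [-> ->]. auto.
  - intros (Hz & Hw & ->). repeat split; auto; try apply sCut_dist; eauto.
Qed.

(** A fraction above the sum of two distances is above each of them by [fr_le_sum], hence above the
    weights of [x] and [z], unless some of the points coincide; those cases are immediate. *)
Lemma triangle x y z : x ∈ Fr -> y ∈ Fr -> z ∈ Fr ->
  exists v, sRealAdd Fr addg mulg v (dist x y) (dist y z) /\ sRealLe (dist x z) v.
Proof.
  intros Hx Hy Hz.
  exists (sep Fr (fun r => exists p, p ∈ dist x y /\ exists q, q ∈ dist y z /\
    exists s, sFracAdd addg mulg s p q /\ sFracLe mulg s r)).
  assert (K : sRealAdd Fr addg mulg (sep Fr (fun r => exists p, p ∈ dist x y /\
    exists q, q ∈ dist y z /\ exists s, sFracAdd addg mulg s p q /\ sFracLe mulg s r))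
    (dist x y) (dist y z)).
  { intros r. rewrite in_sep by (unfold sFracAdd, sFracLe, sFracLt; dp). tauto. }
  split; auto. intros c Hc. apply K in Hc as (Hc & p & Hp & q & Hq & s & Hs & Hle).
  assert (Kp := Hp). assert (Kq := Hq).
  apply mem_dist, proj1, mem_Fr in Kp as (i & j & Hi & Hj & ->).
  apply mem_dist, proj1, mem_Fr in Kq as (k & l & Hk & Hl & ->).
  assert (Kc := Hc). apply mem_Fr in Kc as (a & b & Ha & Hb & ->).
  apply FracAdd_fr in Hs as ->. unfold sFracLe in Hle. rewrite FracLt_fr in Hle.
  assert (Lp : fr a b ∈ dist x y).
  { destruct (sCut_dist x y) as (_ & _ & U & _); auto. apply (U _ Hp); auto.
    apply FracLt_fr. apply (fr_le_sum i j k l a b); auto. }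
  assert (Lq : fr a b ∈ dist y z).
  { destruct (sCut_dist y z) as (_ & _ & U & _); auto. apply (U _ Hq); auto.
    apply FracLt_fr. apply (fr_le_sum k l i j a b); [assumption..|].
    replace (l * j) with (j * l) by ring. replace (k * j + i * l) with (i * l + k * j) by ring.
    exact Hle. }
  rewrite mem_dist in *. intuition congruence.
Qed.

Lemma sMetric_dmet : sMetric dmet Fr reals Fr addg mulg.
Proof.
  split; [|split; [|split]].
  - eexists; split; [reflexivity|]. split; [|split].
    + intros p H. assert (K := H). unfold dmet in H.
      rewrite in_sep in H by (unfold dist, above_wt, inv; dp). destruct H as [H _].
      apply mem_prod in H as (q & Hq & r & Hr & ->). eauto 6.
    + intros p H. apply mem_prod in H as (z & Hz & w & Hw & ->).
      exists (dist z w). apply mem_dmet; auto.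
    + intros p r r' [H K]. assert (L := H). unfold dmet in L.
      rewrite in_sep in L by (unfold dist, above_wt, inv; dp). destruct L as [L _].
      apply opair_in_prod in L as [L _]. apply mem_prod in L as (z & Hz & w & Hw & ->).
      apply mem_dmet in H as (_ & _ & ->), K as (_ & _ & ->). auto.
  - intros x Hx y Hy. rewrite mem_dmet. split.
    + intros (_ & _ & E). apply dist_neq; auto.
    + intros ->. rewrite dist_refl. auto.
  - intros x y r. rewrite !mem_dmet. intros (? & ? & ->). auto using dist_sym.
  - intros x y z r s t. rewrite !mem_dmet. intros ((? & ? & ->) & (_ & ? & ->) & (_ & _ & ->)).
    apply triangle; auto.
Qed.
End Fractions.

(** * The topology *)

Section Topology.
Context {M : Model}.
Implicit Types i j k l : N.
Add Ring N_ring : N_semiring.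

Lemma lt_not_lt x y z : x < y -> ~ z < y -> x < z.
Proof.
  intros H K. destruct (lt_total x z) as [L|[->|L]]; auto; [tauto|].
  destruct K. eapply lt_trans; eauto.
Qed.

Lemma not_lt_add x y z : ~ x < y + z -> ~ x < y /\ ~ x < z.
Proof.
  rewrite !not_lt. intros [d ->]. split; [exists (z + d)|exists (y + d)]; ring.
Qed.

(** Membership is the order of natural numbers, so [~ i ∈ n] says n ≤ i: all but finitely many
    columns means all columns from some [n] on. *)
Definition opens := sep (power Fr) (fun U => center ∈ U ->
  exists n, n ∈ omega /\ forall i j : D, ⟨i, j⟩ ∈ Fr -> ~ i ∈ n -> ⟨i, j⟩ ∈ U).

Lemma mem_opens U : U ∈ opens <-> sub U Fr /\
  (center ∈ U -> exists n : N, forall i j, pos i -> pos j -> ~ i < n -> fr i j ∈ U).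
Proof.
  unfold opens. rewrite in_sep, in_power by dp. split; intros [H K]; split; auto;
    intros L; destruct (K L) as [n Hn].
  - destruct Hn as [Kn Hn]. exists (mkN n Kn). intros i j Hi Hj. apply Hn.
    apply fr_Fr; auto.
  - exists (val n). split; [om|]. intros i j F. assert (F' := F).
    apply mem_Fr in F' as (i' & j' & Hi & Hj & E). apply opair_inj in E as [-> ->].
    apply Hn; auto.
Qed.

Lemma isolated_open U : sub U Fr -> ~ center ∈ U -> U ∈ opens.
Proof. intros H K. apply mem_opens. tauto. Qed.

Lemma sTopology_opens : sTopology Fr opens.
Proof.
  split; [|split; [|split; [|split]]].
  - intros U H. apply mem_opens in H; tauto.
  - exists emp. split; auto. apply isolated_open; [|apply in_emp].
    intros z H. apply in_emp in H; tauto.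
  - apply mem_opens. split; [intros z; auto|]. intros _. exists 0.
    intros. apply fr_Fr; auto.
  - intros C u [H ->]. apply mem_opens. split.
    + intros z K. apply in_bigcup in K as (U & HU & K). apply H, mem_opens in HU.
      apply HU, K.
    + intros K. apply in_bigcup in K as (U & HU & K). assert (L := HU).
      apply H, mem_opens in L as [_ L]. destruct (L K) as [n Hn]. exists n.
      intros i j Hi Hj F. apply in_bigcup. exists U. auto.
  - intros U HU V HV W E. apply mem_opens in HU as [HU KU], HV as [HV KV].
    apply mem_opens. split.
    + intros z Hz. apply HU, E, Hz.
    + intros Hc. apply E in Hc as [CU CV]. destruct (KU CU) as [n Hn], (KV CV) as [m Hm].
      exists (n + m). intros i j Hi Hj F. apply not_lt_add in F as [F G]. apply E; auto.
Qed.

Lemma sMetricTopology_opens : sMetricTopology opens dmet Fr reals Fr.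
Proof.
  intros U. rewrite mem_opens. split; intros [HU H]; split; auto.
  - intros x Hx. destruct (classic (x = center)) as [->|N].
    (* The radius is 1/(n + 1) because [n] may be 0. A point of a column below [n] is farther from
       the center than that. *)
    + destruct (H Hx) as [n Hn]. assert (P : pos (n + 1)).
      { apply pos_iff. eauto. }
      exists (inv (val (n + 1))). split; [apply mem_reals, sCut_inv, P|]. split; [split|].
      * exact (inv_Fr _).
      * intros E. apply (lt_irrefl (n + 1)), (fr_1_inv _ _ P). rewrite <- E.
        apply fr_Fr. auto using pos_1.
      * intros y Hy r [Hr [Lr Nr]]. apply mem_dmet in Hr as (_ & _ & ->).
        apply mem_Fr in Hy as (i & j & Hi & Hj & ->).
        destruct (classic (fr i j = center)) as [->|N]; auto.
        apply Hn; auto. intros L. rewrite dist_center in Lr by auto.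
        revert Lr. apply inv_lt; auto. apply lt_S. auto.
    (* The distance from a point to any other is at least its own weight 1/i, so the ball of that
       radius is a singleton. *)
    + assert (F := HU x Hx). apply mem_Fr in F as (i & j & Hi & Hj & ->).
      exists (inv (val i)). split; [apply mem_reals, sCut_inv, Hi|]. split; [split|].
      * exact (inv_Fr _).
      * intros E. apply (lt_irrefl i), (fr_1_inv _ _ Hi). rewrite <- E.
        apply fr_Fr. auto using pos_1.
      * intros y Hy r [Hr [Lr Nr]]. apply mem_dmet in Hr as (_ & _ & ->).
        destruct (classic (fr i j = y)) as [<-|K]; auto. destruct Nr. apply ext.
        intros z. split; auto. apply dist_sub_inv; auto.
  - intros C. destruct (H _ C) as (e & He & [Le Ne] & K). apply mem_reals in He.
    (* A fraction k/l outside the cut is at most the radius, and 1/i < k/l as soon as i > l; this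
       yields the bound l + 1 on the columns. The fraction k/l itself shows that the distance
       differs from the radius. *)
    assert (exists p, p ∈ Fr /\ ~ p ∈ e) as (p & Hp & Np).
    { apply NNPP. intros X. apply Ne, ext. intros z. split; auto.
      intros Hz. apply NNPP. eauto. }
    apply mem_Fr in Hp as (k & l & Hk & Hl & ->). exists (l + 1). intros i j Hi Hj L.
    destruct (classic (fr i j = center)) as [->|N]; auto.
    apply not_lt in L as [d ->].
    apply (K (fr (l + 1 + d) j)) with (r := inv (val (l + 1 + d))); [apply fr_Fr; auto|].
    split.
    + apply mem_dmet. repeat split; [apply HU; auto|apply fr_Fr; auto|].
      symmetry; apply dist_center; auto.
    + split.
      * intros q Hq. assert (Fq := Le _ Hq). apply mem_Fr in Fq as (a & b & Ha & Hb & ->).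
        apply fr_inv. repeat split; auto.
        assert (X : ~ a * l < k * b).
        { intros X. apply Np. destruct He as (_ & _ & He & _). apply (He _ Hq).
          - apply fr_Fr; auto. - apply FracLt_fr; auto. }
        apply not_lt in X as [c X]. apply pos_iff in Hk as [k' ->], Ha as [a' ->].
        apply lt_iff. exists (k' * b + c + a' + (a' + 1) * d).
        transitivity ((a' + 1) * l + (a' + 1) + (a' + 1) * d); [ring|]. rewrite X. ring.
      * intros E. apply Np. rewrite <- E. apply fr_inv. repeat split; auto.
        apply pos_iff in Hk as [k' ->]. apply lt_iff.
        exists (k' * (l + 1 + d) + d). ring.
Qed.

Lemma sMetrizable_opens : sMetrizable Fr opens.
Proof.
  exists reals, Fr, addg, mulg, dmet.
  exact (conj sNonnegReals_reals (conj sMetric_dmet sMetricTopology_opens)).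
Qed.

(** Of two distinct points one is not the center. Its singleton is open, and so is the complement of
    this singleton. *)
Lemma sHausdorff_opens : sHausdorff Fr opens.
Proof.
  assert (W : forall x y, x ∈ Fr -> y ∈ Fr -> x <> y -> y <> center ->
    exists U V, U ∈ opens /\ V ∈ opens /\ x ∈ U /\ y ∈ V /\ ~ exists z, z ∈ U /\ z ∈ V).
  { intros x y Hx Hy E N. assert (Fy := Hy). apply mem_Fr in Fy as (k & l & Hk & Hl & Ey).
    set (U := sep Fr (fun z => z <> y)).
    assert (HU : forall z, z ∈ U <-> z ∈ Fr /\ z <> y).
    { intros z. apply (in_sep Fr (fun z => z <> y)). dp. }
    exists U, (upair y y). repeat split.
    - apply mem_opens. split; [intros z Hz; apply HU, Hz|]. intros _. exists (k + 1).
      intros i j Hi Hj L. apply HU. split; [apply fr_Fr; auto|]. intros Ez.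
      rewrite Ey in Ez. apply fr_inj in Ez as [-> ->]. apply L, lt_S; auto.
    - apply isolated_open.
      + intros z Hz. apply in_upair in Hz as [->| ->]; auto.
      + rewrite in_upair. intuition.
    - apply HU; auto.
    - apply in_upair; auto.
    - intros (z & Hz & Kz). apply HU in Hz. apply in_upair in Kz. tauto. }
  intros x Hx y Hy E. destruct (classic (y = center)) as [->|N].
  - destruct (W center x) as (U & V & HU & HV & A & B & K); auto.
    exists V. split; auto. exists U. split; auto. repeat split; auto.
    intros (z & ? & ?). apply K. eauto.
  - destruct (W x y) as (U & V & HU & HV & A & B & K); auto.
    exists U. split; auto. exists V. split; auto.
Qed.

(** The code (i + j)^2 + i needs no division by 2, unlike Cantor's. With s = i + j it lies between
    s^2 and (s + 1)^2, so it determines s. *)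
Lemma pairing_lt i j k l : i + j < k + l ->
  (i + j) * (i + j) + i < (k + l) * (k + l) + k.
Proof.
  rewrite !lt_iff. intros [d E]. rewrite E.
  exists (d * (i + j) + d * (i + j) + (i + j) + j + d * d + d + d + k). ring.
Qed.

Lemma pairing_inj i j k l :
  (i + j) * (i + j) + i = (k + l) * (k + l) + k -> i = k /\ j = l.
Proof.
  intros E. assert (S : i + j = k + l).
  { destruct (lt_total (i + j) (k + l)) as [H|[H|H]]; auto; apply pairing_lt in H;
      rewrite E in H; apply lt_irrefl in H; tauto. }
  rewrite S in E. assert (K : i = k).
  { apply add_cancel_r with ((k + l) * (k + l)).
    transitivity ((k + l) * (k + l) + i); [ring|]. rewrite E. ring. }
  split; auto. subst. apply add_cancel_r with k.
  transitivity (k + j); [ring|]. rewrite S. ring.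
Qed.

Lemma sCountable_Fr : sCountable Fr.
Proof.
  set (f := sep (prod Fr omega)
    (fun t => exists i j : D, t = ⟨⟨i, j⟩, add (mul (add i j) (add i j)) i⟩)).
  assert (Hf : forall i j c, ⟨fr i j, c⟩ ∈ f <->
    pos i /\ pos j /\ c = val ((i + j) * (i + j) + i)).
  { intros i j c. unfold f. rewrite in_sep, opair_in_prod, fr_Fr by dp. split.
    - intros [[[Hi Hj] _] (i' & j' & E)]. apply opair_inj in E as [E ->].
      apply opair_inj in E as [<- <-]. auto.
    - intros (Hi & Hj & ->). split; [split; auto; om|]. exists (val i), (val j). auto. }
  exists omega, f. split; [apply sOmega_omega|]. split; [split; [|split]|].
  - intros p H. unfold f in H. rewrite in_sep in H by dp. destruct H as [H _].
    apply mem_prod in H. exact H.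
  - intros p H. apply mem_Fr in H as (i & j & Hi & Hj & ->). eexists. apply Hf; eauto.
  - intros p y z [H K]. assert (L := H). unfold f in L. rewrite in_sep in L by dp.
    destruct L as [L _]. apply opair_in_prod in L as [L _].
    apply mem_Fr in L as (i & j & _ & _ & ->).
    apply Hf in H as (_ & _ & ->), K as (_ & _ & ->). auto.
  - intros p q c [H K].
    assert (forall p, ⟨p, c⟩ ∈ f -> exists i j, p = fr i j) as X.
    { intros p' L. unfold f in L. rewrite in_sep in L by dp. destruct L as [L _].
      apply opair_in_prod in L as [L _]. apply mem_Fr in L as (i & j & _ & _ & ->). eauto. }
    destruct (X p H) as (i & j & ->), (X q K) as (k & l & ->).
    apply Hf in H as (_ & _ & ->), K as (_ & _ & E). apply val_inj, pairing_inj in E.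
    destruct E as [-> ->]. auto.
Qed.

(** * Finite sets *)

Lemma sBijection_bounds f A n x y : sBijection f A n -> ⟨x, y⟩ ∈ f -> x ∈ A /\ y ∈ n.
Proof.
  intros [[[H _] _] _] K. destruct (H _ K) as (x' & Hx & y' & Hy & E).
  apply opair_inj in E as [-> ->]. auto.
Qed.

(** Stands in for the maximum of finitely many bounds. Selecting a bound for each element at once
    would require a function in the model; the induction along the enumeration handles one element
    at a time. *)
Lemma finite_bound A (Q : D -> D -> Prop) : DP (fun r => Q (r 0%nat) (r 1%nat)) ->
  sFinite A -> (forall x, x ∈ A -> exists b : N, Q x (val b)) ->
  (forall x (b c : N), ~ c < b -> Q x (val b) -> Q x (val c)) ->
  exists b : N, forall x, x ∈ A -> Q x (val b).
Proof.
  intros DQ (w & n & f & Hw & Hn & Hf) HQ mono. apply sOmega_unique in Hw as ->.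
  (* A common bound for the elements whose index is below [k]. *)
  assert (P : forall k : D, k ∈ omega -> exists b, b ∈ omega /\
    forall x m, ⟨x, m⟩ ∈ f -> m ∈ k -> Q x b).
  { omega_induct.
    - exists emp. split; [om|]. intros x m _ H. apply in_emp in H; tauto.
    - intros k Hk (b & Hb & IH). destruct (classic (exists x, ⟨x, k⟩ ∈ f)) as [[x Hx]|N].
      + destruct (HQ x (proj1 (sBijection_bounds f A n x k Hf Hx))) as [c Hc].
        exists (val (mkN b Hb + c)). split; [om|]. intros y m Hy Hm.
        apply in_succ in Hm as [Hm| ->].
        * apply (mono y (mkN b Hb)); [|eauto]. apply not_lt. exists c. auto.
        * assert (y = x) as -> by (apply Hf with k; auto).
          apply (mono x c); auto. apply not_lt. exists (mkN b Hb). ring.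
      + exists b. split; auto. intros y m Hy Hm. apply in_succ in Hm as [Hm| ->]; eauto.
        destruct N; eauto. }
  destruct (P n Hn) as (b & Hb & K). exists (mkN b Hb). intros x Hx.
  assert (Hx' := Hx). apply Hf in Hx' as [m Hm].
  apply (K x m); auto. apply (sBijection_bounds f A n x m Hf Hm).
Qed.

Lemma finite_emp : sFinite emp.
Proof.
  exists omega, emp, emp. split; [apply sOmega_omega|]. split; [om|].
  split; [split; [split; [|split]|]|].
  1,2,5: intros x Hx; destruct (in_emp _ Hx).
  1,2: intros x y z [H _]; destruct (in_emp _ H).
Qed.

Lemma finite_insert A v : sFinite A -> sFinite (union2 A (upair v v)).
Proof.
  intros F. destruct (classic (v ∈ A)) as [Hv|Hv].
  { replace (union2 A (upair v v)) with A; auto. apply ext. intros z.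
    rewrite in_union2, in_upair. split; auto. intros [?|[->| ->]]; auto. }
  destruct F as (w & n & f & Hw & Hn & Hf). apply sOmega_unique in Hw as ->.
  assert (E : forall x y, ⟨x, y⟩ ∈ union2 f (upair ⟨v, n⟩ ⟨v, n⟩) <->
    ⟨x, y⟩ ∈ f \/ x = v /\ y = n).
  { intros x y. rewrite in_union2, in_upair. split.
    - intros [H|[H|H]]; auto; apply opair_inj in H; auto.
    - intros [H|[-> ->]]; auto. }
  assert (Bd := fun x y => sBijection_bounds f A n x y Hf).
  assert (EA : forall x, x ∈ union2 A (upair v v) <-> x ∈ A \/ x = v).
  { intros x. rewrite in_union2, in_upair. tauto. }
  destruct Hf as [[[F1 [F2 F3]] F4] F5].
  exists omega, (succ n), (union2 f (upair ⟨v, n⟩ ⟨v, n⟩)).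
  split; [apply sOmega_omega|]. split; [om|]. split; [split; [split; [|split]|]|].
  - intros p H. rewrite in_union2, in_upair in H.
    assert (H' : p ∈ f \/ p = ⟨v, n⟩) by tauto. destruct H' as [H'| ->].
    + destruct (F1 p H') as (x & Hx & y & Hy & ->). exists x. rewrite EA. split; auto.
      exists y. rewrite in_succ. auto.
    + exists v. rewrite EA. split; auto. exists n. rewrite in_succ. auto.
  - intros x Hx. apply EA in Hx as [Hx| ->].
    + destruct (F2 x Hx) as [y Hy]. exists y. apply E; auto.
    + exists n. apply E; auto.
  - intros x y z [H K]. apply E in H, K. destruct H as [H|[-> ->]], K as [K|[K1 K2]]; subst;
    auto.
    + eauto.
    + apply Bd in H; tauto.
    + apply Bd in K; tauto.
  - intros x y z [H K]. apply E in H, K. destruct H as [H|[-> ->]], K as [K|[K1 K2]]; subst;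
    auto.
    + eauto.
    + apply Bd in H. destruct (mem_irrefl n); tauto.
    + apply Bd in K. destruct (mem_irrefl n); tauto.
  - intros y Hy. apply in_succ in Hy as [Hy| ->].
    + destruct (F5 y Hy) as [x Hx]. exists x. apply E; auto.
    + exists v. apply E; auto.
Qed.

(** The second coordinates of a finite set of pairs have a common bound, which column 1 exceeds. *)
Lemma not_sFinite_Fr : ~ sFinite Fr.
Proof.
  intros F.
  destruct (finite_bound Fr (fun z b => forall j : D, j ∈ omega ->
    forall i : D, z = ⟨i, j⟩ -> j ∈ b)) as [b H]; auto.
  - dp.
  - intros x Hx. apply mem_Fr in Hx as (i & j & _ & _ & ->). exists (j + 1).
    intros j' _ i' E. apply opair_inj in E as [_ <-]. apply lt_S; auto.
  - intros x b c Hbc H j Hj i E. apply (lt_not_lt (mkN j Hj) b c); auto. eapply H; eauto.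
  - apply (lt_irrefl (b + 1)). apply lt_S. left.
    apply (H (fr 1 (b + 1))) with (i := val 1); [|om|reflexivity].
    apply fr_Fr. split; [apply pos_1|apply pos_iff; eauto].
Qed.

(** * Compact sets *)

Lemma DP_sFinite t : DT t -> DP (fun r => sFinite (t r)).
Proof.
  intros. unfold sFinite, sBijection, sInjection, sFun, sOmega, sInductive. dp.
Qed.

Lemma DP_sCompact t s u : DT t -> DT s -> DT u -> DP (fun r => sCompact (t r) (s r) (u r)).
Proof.
  intros. unfold sCompact, sCovers, sFinite, sBijection, sInjection, sFun, sOmega, sInductive.
  dp.
Qed.

(** Cover [A] by the sets [O b], which contain every other column and the points of column [n] of
    height below [b]. They increase with [b], so the heights occurring in a finite subcover are
    bounded, and some point of the column is left out. *)
Lemma compact_misses_column A n : sCompact A Fr opens -> pos n ->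
  exists j, pos j /\ ~ fr n j ∈ A.
Proof.
  intros [HA HC] Hn.
  set (O := fun b => sep Fr (fun z => forall j : D, z = ⟨val n, j⟩ -> j ∈ b)).
  assert (HO : forall b z, z ∈ O b <-> z ∈ Fr /\ forall j : D, z = ⟨val n, j⟩ -> j ∈ b).
  { intros b z. apply (in_sep Fr (fun z => forall j : D, z = ⟨val n, j⟩ -> j ∈ b)). dp. }
  set (C := sep opens (fun U => exists b, b ∈ omega /\ U = O b)).
  assert (HC' : forall U, U ∈ C <-> U ∈ opens /\ exists b, b ∈ omega /\ U = O b).
  { intros U. apply (in_sep opens (fun U => exists b, b ∈ omega /\ U = O b)).
    unfold O. dp. }
  destruct (HC C) as (E & HE & FE & CE).
  { split; [intros U HU; apply HC', HU|]. intros z Hz. assert (Fz := HA z Hz).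
    apply mem_Fr in Fz as (i & j & Hi & Hj & ->). exists (O (val (j + 1))). split.
    - apply HC'. split; [|exists (val (j + 1)); split; [om|auto]].
      apply mem_opens. split; [intros z H; apply HO in H; tauto|]. intros _.
      exists (n + 1). intros i' j' Hi' Hj' L. apply HO. split; [apply fr_Fr; auto|].
      intros c Ec. apply opair_inj in Ec as [Ec _]. apply val_inj in Ec as ->.
      destruct L. apply lt_S; auto.
    - apply HO. split; [apply fr_Fr; auto|]. intros c Ec.
      apply opair_inj in Ec as [_ <-]. apply lt_S; auto. }
  destruct (finite_bound E (fun U b => forall j : D, j ∈ omega -> ⟨val n, j⟩ ∈ U -> j ∈ b))
    as [b Hb]; auto.
  - dp.
  - intros U HU. apply HE, HC' in HU as (_ & b & Kb & ->). exists (mkN b Kb).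
    intros j _ Hj. apply HO in Hj as [_ Hj]. apply Hj; auto.
  - intros U b c Hbc H j Hj Kj. apply (lt_not_lt (mkN j Hj) b c); auto. apply H; auto.
  - exists (b + 1). split; [apply pos_iff; eauto|]. intros H.
    destruct (CE _ H) as (U & HU & KU). apply (lt_irrefl (b + 1)), lt_S. left.
    apply (Hb U HU); [om|exact KU].
Qed.

(** A member of the cover that contains the center takes in all columns from some [n] on. Each
    earlier column holds at most one point of [A] and costs at most one further member. *)
Lemma transversal_compact A : sub A Fr -> center ∈ A ->
  (forall i j j', fr i j ∈ A -> fr i j' ∈ A -> j = j') -> sCompact A Fr opens.
Proof.
  intros HA Hc HT. split; auto. intros C [HC CC].
  destruct (CC _ Hc) as (U & HU & KU). assert (OU := HC _ HU).
  apply mem_opens in OU as [SU OU]. destruct (OU KU) as [n Hn].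
  (* The subcover grows column by column, by induction inside the model; a single member of the
     cover is picked at each step. *)
  assert (P : forall k : D, k ∈ omega -> exists E, sub E C /\ sFinite E /\ U ∈ E /\
    forall i j : D, ⟨i, j⟩ ∈ A -> i ∈ k -> exists V, V ∈ E /\ ⟨i, j⟩ ∈ V).
  { omega_induct.
    - eapply DP_ex. apply DP_and; [dp|]. apply DP_and; [apply DP_sFinite|]; dp.
    - exists (union2 emp (upair U U)). repeat split.
      + intros V HV. rewrite in_union2, in_upair in HV.
        destruct HV as [HV|[->| ->]]; auto. apply in_emp in HV; tauto.
      + apply finite_insert, finite_emp.
      + rewrite in_union2, in_upair; auto.
      + intros i j _ H. apply in_emp in H; tauto.
    - intros k Hk (E & SE & FE & UE & KE).
      destruct (classic (exists j : D, ⟨k, j⟩ ∈ A)) as [[j Hj]|N].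
      + destruct (CC _ Hj) as (V & HV & KV). exists (union2 E (upair V V)). repeat split.
        * intros X HX. rewrite in_union2, in_upair in HX. destruct HX as [?|[->| ->]]; auto.
        * apply finite_insert, FE.
        * apply in_union2; auto.
        * intros i j' H L. apply in_succ in L as [L| ->].
          -- destruct (KE i j' H L) as (X & HX & KX). exists X. rewrite in_union2; auto.
          -- exists V. rewrite in_union2, in_upair. split; auto.
             assert (F := HA _ H). apply mem_Fr in F as (a & b & _ & _ & Eq).
             apply opair_inj in Eq as [-> ->].
             assert (F := HA _ Hj). apply mem_Fr in F as (a' & b' & _ & _ & Eq).
             apply opair_inj in Eq as [Eq ->]. rewrite (HT a b b'); auto.
      + exists E. repeat split; auto. intros i j H L. apply in_succ in L as [L| ->]; auto.
        destruct N; eauto. }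
  destruct (P (val n) ltac:(om)) as (E & SE & FE & UE & KE). exists E. split; [auto|].
  split; auto. intros z Hz. assert (Fz := HA _ Hz).
  apply mem_Fr in Fz as (i & j & Hi & Hj & ->).
  destruct (classic (i < n)) as [L|L].
  - apply KE; auto.
  - exists U. auto.
Qed.

Definition cc_opens := sep (power Fr) (fun U => U = emp \/
  exists A, sCompact A Fr opens /\ forall x, x ∈ U <-> (x ∈ Fr /\ ~ x ∈ A)).

Lemma sCompactComplementTopology_cc : sCompactComplementTopology cc_opens Fr opens.
Proof.
  intros U. unfold cc_opens. rewrite in_sep, in_power.
  - split; [tauto|]. intros H; split; auto. destruct H as [->|(A & _ & E)].
    + intros z H. apply in_emp in H; tauto.
    + intros z H. apply E, H.
  - apply DP_or; [dp|]. eapply DP_ex, DP_and; [apply DP_sCompact|]; dp.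
Qed.

Lemma not_sFirstCountable_cc : ~ sFirstCountable Fr cc_opens.
Proof.
  assert (p2 : pos (1 + 1)) by (apply pos_iff; eauto).
  (* Countability gives an injection [g] of the base into omega rather than an enumeration; the
     index of [U] is its value under [g]. *)
  intros FC. destruct (FC (fr 1 (1 + 1))) as (B & (w & g & Hw & Hg) & HB & Hbase).
  { apply fr_Fr. auto using pos_1. }
  apply sOmega_unique in Hw as ->. destruct Hg as [[G1 [G2 G3]] G4].
  (* Minimality of [j] makes the chosen points definable, so that Separation forms the set K of the
     overview. *)
  set (Q := fun z => z = center \/ exists U n j : D, U ∈ B /\ ⟨U, n⟩ ∈ g /\
    z = ⟨succ (succ n), j⟩ /\ z ∈ U /\ forall j' : D, ⟨succ (succ n), j'⟩ ∈ U -> ~ j' ∈ j).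
  assert (HK : forall z, z ∈ sep Fr Q <-> z ∈ Fr /\ Q z).
  { intros z. apply in_sep. unfold Q. dp. }
  assert (QS : forall i j, Q (fr i j) -> fr i j = center \/ exists U n : D,
    ⟨U, n⟩ ∈ g /\ val i = succ (succ n) /\ fr i j ∈ U /\
    forall j' : D, ⟨succ (succ n), j'⟩ ∈ U -> ~ j' ∈ val j).
  { intros i j [H|(U & n & j' & _ & Hn & E & HU & HJ)]; auto. right.
    apply opair_inj in E as [Ei <-]. eauto 8. }
  assert (N1 : forall n, val 1 <> succ (succ n)).
  { intros n E. apply succ_inj in E. symmetry in E. apply succ_emp in E; auto. }
  assert (CK : sCompact (sep Fr Q) Fr opens).
  { apply transversal_compact.
    - intros z H. apply HK, H.
    - apply HK. split; [apply fr_Fr; auto using pos_1|left; auto].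
    - intros i j j' H H'. apply HK in H as [Fz H], H' as [Fz' H'].
      apply QS in H as [H|(U & n & Hn & E & HU & HJ)],
        H' as [H'|(U' & n' & Hn' & E' & HU' & HJ')].
      + apply fr_inj in H as [-> ->], H' as [_ ->]. auto.
      + apply fr_inj in H as [-> ->]. apply N1 in E'; tauto.
      + apply fr_inj in H' as [-> ->]. apply N1 in E; tauto.
      (* The column determines the index, injectivity of [g] then determines [U], and minimality
         determines the height. *)
      + assert (n' = n) as -> by (apply succ_inj, succ_inj; congruence).
        assert (U' = U) as -> by eauto. unfold fr in HU, HU'. rewrite E in HU, HU'.
        destruct (lt_total j j') as [L|[L|L]]; auto.
        * destruct (HJ' _ HU L).
        * destruct (HJ _ HU' L). }
  assert (HV : forall z, z ∈ sep Fr (fun z => ~ z ∈ sep Fr Q) <-> z ∈ Fr /\ ~ z ∈ sep Fr Q).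
  { intros z. rewrite in_sep; [tauto|]. unfold Q. dp. }
  destruct (Hbase (sep Fr (fun z => ~ z ∈ sep Fr Q))) as (U & HU & SU).
  - apply sCompactComplementTopology_cc. right. eauto.
  - apply HV. split; [apply fr_Fr; auto using pos_1|]. intros H.
    apply HK in H as [_ H]. apply QS in H as [H|(U & n & _ & E & _)].
    + apply fr_inj in H as [_ H]. apply (lt_irrefl 1). rewrite <- H at 2.
      apply lt_S; auto.
    + apply N1 in E; auto.
  - destruct (HB U HU) as [OU XU]. apply sCompactComplementTopology_cc in OU.
    destruct OU as [->|(A & CA & EA)]; [apply in_emp in XU; auto|].
    destruct (G2 U HU) as [n Hn].
    assert (Kn : n ∈ omega).
    { destruct (G1 _ Hn) as (x & _ & y & Hy & E). apply opair_inj in E as [_ ->]. auto. }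
    set (m := NS (NS (mkN n Kn))).
    (* [U] is the complement of the compact set [A], so it meets column n + 2. *)
    destruct (compact_misses_column A m CA) as (j & Hj & Mj). { apply succ_emp. }
    set (J := sep omega (fun j : D => ⟨val m, j⟩ ∈ U)).
    assert (HJ : forall j : D, j ∈ J <-> j ∈ omega /\ ⟨val m, j⟩ ∈ U).
    { intros j'. apply (in_sep omega (fun j : D => ⟨val m, j⟩ ∈ U)). dp. }
    (* An element of [J] that is minimal for membership is its least number. *)
    destruct (foundation J) as (j0 & K0 & Min).
    { exists (val j). apply HJ. split; [om|]. apply EA. split; auto.
      apply fr_Fr. split; auto. apply succ_emp. }
    (* The point at height [j0] lies in [U] and hence outside K, yet it is the point of K chosen for
       [U]. *)
    apply HJ in K0 as [Oj K0]. assert (L := SU _ K0). apply HV in L as [Fz L].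
    apply L, HK. split; auto. right. exists U, n, j0. repeat split; auto.
    intros j' Hj' Lt. apply Min. exists j'. split; auto. apply HJ. split; auto.
    eapply omega_trans; eauto.
Qed.

Theorem model_satisfies : exists Z T S, sTopology Z T /\ sCountable Z /\ sMetrizable Z T /\
  sHausdorff Z T /\ ~ sFinite Z /\ sCompactComplementTopology S Z T /\ ~ sFirstCountable Z S.
Proof.
  exists Fr, opens, cc_opens.
  exact (conj sTopology_opens (conj sCountable_Fr (conj sMetrizable_opens
    (conj sHausdorff_opens (conj not_sFinite_Fr (conj sCompactComplementTopology_cc
      not_sFirstCountable_cc)))))).
Qed.
End Topology.

Theorem mainTheorem2 :
  provable ZF (sentence (∃ Z T S,
    Topology Z T ∧ Countable Z ∧ Metrizable Z T ∧
    Hausdorff Z T ∧ ¬ Finite Z ∧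
    CompactComplementTopology S Z T ∧ ¬ FirstCountable Z S)%fml).
Proof. exact (provable_of_models (@model_satisfies)). Qed.
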